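(* Let $E$ be a Fréchet space, let $\ell,\tilde\ell\in\Lambda$, and let $B=(b_i^k)$ and $C=(c_j^k)$ be Köthe matrices such that the $\ell$-Köthe space $\lambda^{\ell}(B)$ is nuclear. Then $(E,\lambda^{\ell}(B),\lambda^{\tilde\ell}(C))\in\mathcal{BF}$ if and only if for every sequence $N:\mathbb{N}\to\mathbb{N}$, $k\mapsto N(k)$, there is $N\in\mathbb{N}$ such that for each $r\in\mathbb{N}$ there are $k_0\in\mathbb{N}$ and a constant $M>0$ with $$c_j^{r}\,\|u\|_{N}^{*}\le M\max_{1\le k\le k_0}\left\{\|u\|_{N(k)}^{*}\,b_i^{k}\right\}\ \max_{1\le k\le k_0}\left\{\frac{c_j^{k}}{b_i^{N(k)}}\right\}$$ for all $i\in\mathbb{N}$, $j\in\mathbb{N}$ and $u\in E'$.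
   Context: The topology of a Fréchet space $E$ is given by a fixed increasing fundamental sequence of seminorms $(\|\cdot\|_k)_{k\in\mathbb{N}}$. $E'$ is the topological dual of $E$, and for $u\in E'$, $\|u\|_q^{*}=\sup\{|u(x)|: x\in E,\ \|x\|_q\le 1\}\in[0,+\infty]$. Conventions for degenerate values: $0\cdot\infty=0$ in the individual terms $c_j^r\|u\|_N^*$ and $\|u\|_{N(k)}^*b_i^k$; $\frac{t}{0}=+\infty$ for $t>0$ and $\frac{0}{0}=0$; and the displayed inequality is regarded as trivially satisfied if one of the two maxima on its right-hand side is $+\infty$. A Köthe matrix is an infinite matrix $A=(a_n^k)_{n,k\in\mathbb{N}}$ of real numbers with $0\le a_n^k\le a_n^{k+1}$ for all $n,k$ and $\sup_k a_n^k>0$ for every $n$. $\Lambda$ is the class of Banach sequence spaces $\ell$ in which the canonical unit vectors $(e_n)$ form an unconditional basis and whose norm $\|\cdot\|$ is monotone: $\|x\|\le\|y\|$ whenever $x=(x_n),y=(y_n)\in\ell$ satisfy $|x_n|\le|y_n|$ for all $n$; moreover $\|e_n\|=1$ for all $n$. For $\ell\in\Lambda$ and a Köthe matrix $A$, the $\ell$-Köthe space $\lambda^{\ell}(A)$ is the Fréchet space of all scalar sequences $x=(x_n)$ such that $(x_na_n^k)_n\in\ell$ for every $k$, with seminorms $\|x\|_k=\|(x_na_n^k)_n\|$; thus $\|e_n\|_k=a_n^k$. For a linear operator $T:E\to F$ between Fréchet spaces, $\|T\|_{p,q}=\sup\{\|Tx\|_p:\|x\|_q\le1\}\in[0,+\infty]$.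 $T$ is bounded if there is $N\in\mathbb{N}$ with $\|T\|_{r,N}<\infty$ for all $r\in\mathbb{N}$. For Fréchet spaces $E,F,G$, the triple $(E,F,G)$ has the bounded factorization property, written $(E,F,G)\in\mathcal{BF}$, if each continuous linear operator $T:E\to G$ that factors over $F$ (i.e. $T=RS$ with continuous linear operators $S:E\to F$ and $R:F\to G$) is bounded. *)

(* Defs.v *)
From HB Require Import structures.
From mathcomp Require Import all_boot all_order all_algebra.
From mathcomp Require Import all_classical all_reals all_analysis.
From mathcomp Require Import complex.

Set Implicit Arguments.
Unset Strict Implicit.
Unset Printing Implicit Defensive.

Import Order.TTheory GRing.Theory Num.Theory.
Import numFieldNormedType.Exports.

Local Open Scope classical_set_scope.
Local Open Scope ring_scope.

(* The scalar field is the field of the real or of the complex numbers. *)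
Variant scalars := RealScalars | ComplexScalars.

Definition scalar_field (R : realType) (s : scalars) : numFieldType :=
  match s with RealScalars => R | ComplexScalars => complex R end.

Definition of_real (R : realType) (s : scalars) : {rmorphism R -> scalar_field R s} :=
  match s with
  | RealScalars => idfun : {rmorphism R -> R}
  | ComplexScalars => real_complex R : {rmorphism R -> complex R}
  end.
Arguments of_real {R} s.

Definition real_part (R : realType) (s : scalars) : scalar_field R s -> R :=
  match s with RealScalars => id | ComplexScalars => @complex.Re R end.

(* MathComp norms over a numDomainType K take their values in K; rnorm is the
   same norm with values in the reals (see rnormE). It applies to elements of
   normed modules as well as to scalars. *)
Definition rnorm (R : realType) (s : scalars) (V : normedZmodType (scalar_field R s))
  (x : V) : R := real_part `|x|.

Section scalars.
Context (R : realType) (s : scalars).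
Local Notation K := (scalar_field R s).

Lemma real_part_of_real (x : R) : real_part (of_real s x) = x.
Proof. by case: s. Qed.

Lemma of_real_le : {mono of_real s : x y / (x : R) <= y >-> (x : K) <= y}.
Proof. by case: s => x y //=; exact: lecR. Qed.

Lemma of_real_lt : {mono of_real s : x y / (x : R) < y >-> (x : K) < y}.
Proof. by case: s => x y //=; exact: ltcR. Qed.

Lemma of_real_inj : injective (of_real s : R -> K).
Proof. exact: fmorph_inj. Qed.

Lemma ge0_of_real (x : K) : 0 <= x -> of_real s (real_part x) = x.
Proof.
case: s x => //= -[a b] /=; rewrite lecE /= => /andP[/eqP -> _].
by [].
Qed.

Lemma rnormE (V : normedZmodType K) (x : V) : `|x| = of_real s (rnorm x).
Proof. by rewrite /rnorm ge0_of_real. Qed.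

Lemma rnorm_of_real (x : R) : rnorm (of_real s x) = `|x|.
Proof.
apply: of_real_inj; rewrite -rnormE.
have [x0|x0] := leP 0 x.
  by rewrite (ger0_norm x0) ger0_norm// -(rmorph0 (of_real s)) of_real_le.
rewrite (ltr0_norm x0) rmorphN ltr0_norm//.
by rewrite -(rmorph0 (of_real s)) of_real_lt.
Qed.

Lemma rnorm_le (V W : normedZmodType K) (x : V) (y : W) :
  (rnorm x <= rnorm y) = (`|x| <= `|y|).
Proof. by rewrite !rnormE of_real_le. Qed.

Lemma rnorm_lt (V W : normedZmodType K) (x : V) (y : W) :
  (rnorm x < rnorm y) = (`|x| < `|y|).
Proof. by rewrite !rnormE of_real_lt. Qed.

Lemma rnorm_ge0 (V : normedZmodType K) (x : V) : 0 <= rnorm x.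
Proof. by rewrite -of_real_le -rnormE rmorph0. Qed.

Lemma rnorm0 (V : normedZmodType K) : rnorm (0 : V) = 0.
Proof. by apply: of_real_inj; rewrite -rnormE normr0 rmorph0. Qed.

Lemma rnorm0_eq0 (V : normedZmodType K) (x : V) : rnorm x = 0 -> x = 0.
Proof. by move=> x0; apply: normr0_eq0; rewrite rnormE x0 rmorph0. Qed.

Lemma rnormN (V : normedZmodType K) (x : V) : rnorm (- x) = rnorm x.
Proof. by rewrite /rnorm normrN. Qed.

Lemma rnormM (x y : K) : rnorm (x * y) = rnorm x * rnorm y.
Proof. by apply: of_real_inj; rewrite rmorphM -!rnormE normrM. Qed.

Lemma rnormD (V : normedZmodType K) (x y : V) :
  rnorm (x + y) <= rnorm x + rnorm y.
Proof. by rewrite -of_real_le rmorphD/= -!rnormE ler_normD. Qed.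

Lemma rnormZ (V : normedModType K) (a : K) (x : V) :
  rnorm (a *: x) = rnorm a * rnorm x.
Proof. by apply: of_real_inj; rewrite rmorphM -!rnormE normrZ. Qed.

End scalars.

Definition seminorm_cauchy (R : realType) (E : zmodType) (p : nat -> E -> R)
  (u : nat -> E) := forall k (e : R), 0 < e ->
  exists n0, forall m n, (n0 <= m)%N -> (n0 <= n)%N -> p k (u m - u n) < e.

(* A Frechet space together with a fixed increasing fundamental sequence of
   seminorms, indexed from 0. Completeness is stated with the seminorms because the uniform
   structure of a tvsType is not required to be translation invariant. *)
HB.mixin Record isFrechet (R : realType) (s : scalars) E
    & Tvs (scalar_field R s) E := {
  seminorm : nat -> E -> R ;
  seminormD : forall k x y, seminorm k (x + y) <= seminorm k x + seminorm k y ;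
  seminormZ : forall k (a : scalar_field R s) x,
    seminorm k (a *: x) = rnorm a * seminorm k x ;
  seminormS : forall k x, seminorm k x <= seminorm k.+1 x ;
  nbhs_seminormP : forall (x : E) (A : set E),
    nbhs x A <-> exists k, exists2 e : R, 0 < e &
                 forall y, seminorm k (y - x) < e -> A y ;
  frechet_hausdorff : hausdorff_space E ;
  frechet_complete : forall u : nat -> E, seminorm_cauchy seminorm u ->
    exists x : E, u n @[n --> \oo] --> x
}.

#[short(type="frechetType")]
HB.structure Definition Frechet (R : realType) (s : scalars) :=
  {E of Tvs (scalar_field R s) E & isFrechet R s E}.

(* Construction of a Frechet space from a separating, complete, increasing
   sequence of seminorms on a vector space. *)
HB.factory Record Lmodule_isFrechet (R : realType) (s : scalars) E
    & GRing.Lmodule (scalar_field R s) E := {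
  sn : nat -> E -> R ;
  snD : forall k x y, sn k (x + y) <= sn k x + sn k y ;
  snZ : forall k (a : scalar_field R s) x, sn k (a *: x) = rnorm a * sn k x ;
  snS : forall k x, sn k x <= sn k.+1 x ;
  sn_separating : forall x, (forall k, sn k x = 0) -> x = 0 ;
  sn_complete : forall u : nat -> E, seminorm_cauchy sn u ->
    exists x, forall k, sn k (u n - x) @[n --> \oo] --> (0 : R)
}.

HB.builders Context R s E & Lmodule_isFrechet R s E.
Local Notation K := (scalar_field R s).

Let nb (x : E) : set_system E := [set A | exists k, exists2 e : R, 0 < e &
                 forall y, sn k (y - x) < e -> A y].

Let sn0 k : sn k 0 = 0.
Proof. by rewrite -(scale0r 0) snZ rnorm0 mul0r. Qed.

Let snN k x : sn k (- x) = sn k x.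
Proof. by rewrite -scaleN1r snZ rnormN -(rmorph1 (of_real s)) rnorm_of_real normr1 mul1r. Qed.

Let sn_ge0 k x : 0 <= sn k x.
Proof.
by have := snD k x (- x); rewrite subrr sn0 snN -mulr2n pmulrn_lge0.
Qed.

Let sn_mono k l x : (k <= l)%N -> sn k x <= sn l x.
Proof.
move=> /subnK <-; elim: (l - k)%N => //= n IH.
by rewrite addSn (le_trans IH)// snS.
Qed.

Let snB k x y z : sn k (x - z) <= sn k (x - y) + sn k (y - z).
Proof. by rewrite (le_trans _ (snD _ _ _))// addrA subrK. Qed.

#[warning="-HB.no-new-instance"]
HB.instance Definition _ := hasNbhs.Build E nb.

Let nb_filter (p : E) : ProperFilter (nbhs p).
Proof.
split; first by move=> [k [e e0 /(_ p)]]; apply; rewrite subrr sn0.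
split.
- by exists 0%N, 1.
- move=> P Q [k [e e0 eP]] [l [d d0 dQ]].
  exists (maxn k l), (Num.min e d); first by rewrite lt_min e0.
  move=> y; rewrite lt_min => /andP[ye yd]; split.
    by apply: eP; rewrite (le_lt_trans _ ye)// sn_mono// leq_maxl.
  by apply: dQ; rewrite (le_lt_trans _ yd)// sn_mono// leq_maxr.
- by move=> P Q PQ [k [e e0 eP]]; exists k, e => // y /eP /PQ.
Qed.

Let nb_singleton (p : E) (A : set E) : nbhs p A -> A p.
Proof. by move=> [k [e e0]]; apply; rewrite subrr sn0. Qed.

Let nb_nbhs (p : E) (A : set E) : nbhs p A -> nbhs p (nbhs^~ A).
Proof.
move=> [k [e e0 eA]]; exists k, e => // y ye.
exists k, (e - sn k (y - p)); first by rewrite subr_gt0.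
by move=> z; rewrite ltrBrDr => ze; apply: eA; rewrite (le_lt_trans _ ze)// snB.
Qed.

HB.instance Definition _ :=
  Nbhs_isNbhsTopological.Build E nb_filter nb_singleton nb_nbhs.

Let sn_ball k (e : R) (x : E) : 0 < e -> nbhs x [set y | sn k (y - x) < e].
Proof. by move=> e0; exists k, e. Qed.

Let add_cont : continuous (fun x : E * E => x.1 + x.2).
Proof.
move=> [x y] A [k [e e0 eA]].
exists ([set z | sn k (z - x) < e / 2], [set z | sn k (z - y) < e / 2]).
  by split; apply: sn_ball; rewrite divr_gt0.
move=> [a b] /= [ax by_]; apply: eA.
by rewrite opprD addrACA (le_lt_trans (snD _ _ _))// (splitr e) ltrD.
Qed.

Let scale_cont : continuous (fun z : K^o * E => z.1 *: z.2).
Proof.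
move=> [a x] A [k [e e0 eA]].
pose M := rnorm a + sn k x + 1.
have M0 : 0 < M by rewrite ltr_pwDr// addr_ge0// rnorm_ge0.
pose d := Num.min 1 (e / (M *+ 2)).
have d0 : 0 < d by rewrite lt_min ltr01 divr_gt0// mulrn_wgt0.
exists ([set b : K^o | rnorm (b - a) < d], [set z | sn k (z - x) < d]).
  split; last exact: sn_ball.
  exists (of_real s d) => /=; first by rewrite -(rmorph0 (of_real s)) of_real_lt.
  by move=> b /=; rewrite distrC rnormE of_real_lt.
move=> [b y] /= [ba yx]; apply: eA.
have -> : b *: y - a *: x = b *: (y - x) + (b - a) *: x.
  by rewrite scalerBr scalerBl addrA subrK.
rewrite (le_lt_trans (snD _ _ _))// !snZ.
have bM : rnorm b <= rnorm a + 1.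
  rewrite -[b](subrK a) addrC (le_trans (rnormD _ _))// lerD2l ltW//.
  by rewrite (lt_le_trans ba)// ge_min lexx.
have dM : d * M < e.
  rewrite (@le_lt_trans _ _ (e / 2))//; last by rewrite gtr_pMr// invf_lt1// ltr1n.
  rewrite -ler_pdivlMr// -mulrA -invfM mulr_natl.
  by rewrite ge_min lexx orbT.
apply: le_lt_trans dM.
rewrite /M addrAC mulrDr lerD//.
  by rewrite mulrC ler_pM// ?rnorm_ge0// ltW.
by rewrite ler_wpM2r// ltW.
Qed.

Let nb_convex : exists2 B : set_system E,
  (forall b, b \in B -> convex_set b) & basis B.
Proof.
exists [set B | exists x k (e : R), 0 < e /\ B = [set y | sn k (y - x) < e]].
  move=> B; rewrite inE => -[x [k [e [e0 ->]]]] y z l; rewrite !inE/= => ye ze.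
  have -> : conv l y z - x =
      l%:num *: ((y : E) - x) + (1 - l%:num) *: ((z : E) - x).
    rewrite !scalerBr addrACA -opprD -scalerDl.
    by rewrite [l%:num + _]addrC subrK scale1r.
  have l0 : 0 <= l%:num :> K by [].
  have l1 : 0 <= 1 - l%:num :> K by rewrite subr_ge0.
  pose m := Num.max (sn k (y - x)) (sn k (z - x)).
  have me : m < e by rewrite gt_max ye ze.
  apply: le_lt_trans me; rewrite (le_trans (snD _ _ _))// !snZ.
  have -> : m = rnorm l%:num * m + rnorm (1 - l%:num) * m.
    rewrite -mulrDl -[LHS]mul1r; congr (_ * _).
    apply: (@of_real_inj _ s); rewrite rmorphD/= -!rnormE !ger0_norm//.
    by rewrite rmorph1 addrC subrK.
  by rewrite lerD// ler_wpM2l ?rnorm_ge0// le_max lexx ?orbT.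
split.
  move=> B [x [k [e [e0 ->]]]]; rewrite openE => y /= ye.
  exists k, (e - sn k (y - x)); first by rewrite subr_gt0.
  by move=> z; rewrite ltrBrDr => ze /=; rewrite (le_lt_trans _ ze)// snB.
move=> x A [k [e e0 eA]]; exists [set y | sn k (y - x) < e] => //.
split; first by exists x, k, e.
by rewrite /= subrr sn0.
Qed.

HB.instance Definition _ :=
  PreTopologicalLmod_isTvs.Build K E add_cont scale_cont nb_convex.
HB.instance Definition _ :=
  PreTopologicalNmodule_isTopologicalNmodule.Build E add_cont.
HB.instance Definition _ :=
  TopologicalNmodule_isTopologicalLmodule.Build K E scale_cont.
HB.instance Definition _ := Uniform_isTvs.Build K E nb_convex.

Let nbE (x : E) (A : set E) : nbhs x A <-> exists k, exists2 e : R, 0 < e &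
                 forall y, sn k (y - x) < e -> A y.
Proof. by []. Qed.

Let sn_hausdorff : hausdorff_space E.
Proof.
move=> p q pq; apply/eqP; rewrite -subr_eq0; apply/eqP/sn_separating => k.
apply/eqP; rewrite eq_le sn_ge0 andbT; apply/ler_addgt0Pr => e e0.
have [//||z [/= zp zq]] := pq _ _ (@sn_ball k (e / 2) p _) (@sn_ball k (e / 2) q _).
- by rewrite divr_gt0.
- by rewrite divr_gt0.
rewrite add0r (splitr e) (le_trans (snB _ _ z _))// lerD// ?ltW//.
by rewrite -snN opprB.
Qed.

Let sn_cauchy (u : nat -> E) : seminorm_cauchy sn u ->
  exists x : E, u n @[n --> \oo] --> x.
Proof.
move=> /sn_complete[x ux]; exists x => A [k [e e0 eA]].
have /cvgrPdist_lt/(_ e e0) := ux k; apply: filterS => n /=.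
by rewrite sub0r normrN ger0_norm//; exact: eA.
Qed.

HB.instance Definition _ := isFrechet.Build R s E snD snZ snS nbE
  sn_hausdorff sn_cauchy.

HB.end.

Section operators.
Context (R : realType) (s : scalars).
Local Notation K := (scalar_field R s).

(* For p, q seminorms on V, W this is sup {q (T x) : p x <= 1} in [0, +oo]. *)
Definition opnorm (V W : Type) (p : V -> R) (q : W -> R) (T : V -> W) : \bar R :=
  ereal_sup [set (q (T x))%:E | x in [set x | p x <= 1]].

Definition dualnorm (E : frechetType R s) (N : nat) (u : E -> K^o) : \bar R :=
  opnorm (seminorm N : E -> R) (@rnorm R s K^o) u.

Definition bounded_operator (E G : frechetType R s) (T : E -> G) :=
  exists N, forall r,
    (opnorm (seminorm N : E -> R) (seminorm r : G -> R) T < +oo)%E.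

Definition bounded_factorization (E F G : frechetType R s) :=
  forall T : {linear E -> G}, continuous T ->
    (exists (S : {linear E -> F}) (Q : {linear F -> G}),
      [/\ continuous S, continuous Q & T = Q \o S :> (E -> G)]) ->
    bounded_operator T.

Definition nuclear_operator (X Y : completeNormedModType K) (T : X -> Y) :=
  exists (u : nat -> {linear X -> K^o}) (y : nat -> Y),
    [/\ forall n, continuous (u n),
        (\sum_(0 <= n <oo) (opnorm (@rnorm R s X) (@rnorm R s K^o) (u n) *
                            (rnorm (y n))%:E) < +oo)%E &
        forall x, series (fun n => u n x *: y n) @ \oo --> T x].

(* (X, j) is the completion of the quotient of E by the kernel of the k-th
   seminorm, which is unique up to isometry. *)
Definition local_banach (E : frechetType R s) (k : nat)
    (X : completeNormedModType K) (j : E -> X) :=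
  (forall x, rnorm (j x) = seminorm k x) /\ dense (range j).

(* The canonical map from the local Banach space of the q-th seminorm to that
   of the p-th one is the continuous linear T such that T \o jq = jp. *)
Definition nuclear (E : frechetType R s) :=
  forall p, exists2 q, (p <= q)%N &
  exists (Xp Xq : completeNormedModType K)
         (jp : {linear E -> Xp}) (jq : {linear E -> Xq}) (T : {linear Xq -> Xp}),
    [/\ local_banach p jp, local_banach q jq,
        continuous T, T \o jq = jp :> (E -> Xp) & nuclear_operator T].

Definition schauder_basis (V : normedModType K) (e : nat -> V) :=
  forall x : V, exists! a : nat -> K, series (fun n => a n *: e n) @ \oo --> x.

Definition unconditional_basis (V : normedModType K) (e : nat -> V) :=
  schauder_basis e /\
  forall (a : nat -> K) (x : V) (sigma : nat -> nat), bijective sigma ->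
    series (fun n => a n *: e n) @ \oo --> x ->
    series (fun n => a (sigma n) *: e (sigma n)) @ \oo --> x.

(* A Banach sequence space is a Banach space whose elements are identified
   with scalar sequences through the injective linear map coord. *)
Record lambda_space := LambdaSpace {
  lambda_carrier :> completeNormedModType K ;
  coord : {linear lambda_carrier -> (nat -> K)} ;
  coord_inj : injective coord ;
  unit_vector : nat -> lambda_carrier ;
  coord_unit_vector : forall n, coord (unit_vector n) = fun m => (m == n)%:R ;
  unit_vector_basis : unconditional_basis unit_vector ;
  norm_monotone : forall x y : lambda_carrier,
    (forall n, `|coord x n| <= `|coord y n|) -> `|x| <= `|y| ;
  norm_unit_vector : forall n, `|unit_vector n| = 1
}.

End operators.

Record kothe_matrix (R : realType) := KotheMatrix {
  kothe_coef :> nat -> nat -> R ;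
  kothe_ge0 : forall n k, 0 <= kothe_coef n k ;
  kothe_mono : forall n k, kothe_coef n k <= kothe_coef n k.+1 ;
  kothe_sup_gt0 : forall n,
    (0 < ereal_sup (range (fun k => (kothe_coef n k)%:E)))%E
}.

Section kothe_space.
Context (R : realType) (s : scalars) (l : lambda_space R s).
Context (A : kothe_matrix R).
Local Notation K := (scalar_field R s).

Definition weighted (k : nat) (x : nat -> K) : nat -> K :=
  fun n => x n * of_real s (A n k).

Definition kothe_pred : {pred (nat -> K)} :=
  mem [set x | forall k, range (coord l) (weighted k x)].

Record kothe_space := KotheSpace {
  kothe_seq :> nat -> K ;
  kothe_seqP : kothe_seq \in kothe_pred
}.

HB.instance Definition _ := [isSub for kothe_seq].
HB.instance Definition _ := [Choice of kothe_space by <:].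

Lemma weightedP k a x y :
  weighted k (a *: x + y) = a *: weighted k x + weighted k y.
Proof.
apply/funext => n.
rewrite -[RHS]/(a * (x n * of_real s (A n k)) + y n * of_real s (A n k)).
by rewrite -[LHS]/((a * x n + y n) * of_real s (A n k)) mulrDl mulrA.
Qed.

Lemma kothe_submod_closed : submod_closed kothe_pred.
Proof.
split.
  rewrite inE => k; exists 0 => //; rewrite linear0.
  by apply/funext => n; rewrite /weighted/= mul0r.
move=> a x y; rewrite !inE => xP yP k.
have [v _ vE] := xP k; have [w _ wE] := yP k.
by exists (a *: v + w) => //; rewrite linearP vE wE weightedP.
Qed.

HB.instance Definition _ := GRing.isSubmodClosed.Build _ _ kothe_pred
  kothe_submod_closed.
HB.instance Definition _ := [SubChoice_isSubLmodule of kothe_space by <:].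

(* The element of l with coordinates (x_n a_n^k)_n. *)
Definition kothe_elt (k : nat) (x : kothe_space) : l :=
  xget 0 [set v | coord l v = weighted k x].

Definition kothe_norm (k : nat) (x : kothe_space) : R := rnorm (kothe_elt k x).

Lemma coord_kothe_elt k x : coord l (kothe_elt k x) = weighted k x.
Proof.
rewrite /kothe_elt; case: xgetP => [v _ //|noelt].
have := kothe_seqP x; rewrite inE => /(_ k)[v _ vE].
by have := noelt v; rewrite /= vE.
Qed.

Lemma kothe_elt_linear k : linear (kothe_elt k).
Proof.
move=> a x y; apply: (@coord_inj _ _ l).
by rewrite linearP !coord_kothe_elt -weightedP.
Qed.

Lemma kothe_eltD k x y : kothe_elt k (x + y) = kothe_elt k x + kothe_elt k y.
Proof. by have := kothe_elt_linear k 1 x y; rewrite !scale1r. Qed.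

Lemma kothe_eltZ k a x : kothe_elt k (a *: x) = a *: kothe_elt k x.
Proof.
have e0 : kothe_elt k 0 = 0.
  by apply: (addrI (kothe_elt k 0)); rewrite -kothe_eltD !addr0.
by have := kothe_elt_linear k a x 0; rewrite !addr0 e0 addr0.
Qed.

Lemma kothe_normD k x y :
  kothe_norm k (x + y) <= kothe_norm k x + kothe_norm k y.
Proof. by rewrite /kothe_norm kothe_eltD rnormD. Qed.

Lemma kothe_normZ k (a : K) x :
  kothe_norm k (a *: x) = rnorm a * kothe_norm k x.
Proof. by rewrite /kothe_norm kothe_eltZ rnormZ. Qed.

Lemma kothe_normS k x : kothe_norm k x <= kothe_norm k.+1 x.
Proof.
rewrite /kothe_norm rnorm_le norm_monotone// => n.
rewrite !coord_kothe_elt /weighted !normrM ler_wpM2l// -rnorm_le !rnorm_of_real.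
by rewrite !ger0_norm ?kothe_ge0// kothe_mono.
Qed.

Lemma kothe_coef_gt0 n : exists k, 0 < A n k.
Proof.
have /ereal_sup_gt[_ [k _ <-]] := kothe_sup_gt0 A n.
by rewrite lte_fin => Ank; exists k.
Qed.

Lemma of_real_neq0 (r : R) : 0 < r -> of_real s r != 0.
Proof. by move=> r0; rewrite fmorph_eq0 gt_eqF. Qed.

Lemma kothe_separating x : (forall k, kothe_norm k x = 0) -> x = 0.
Proof.
move=> x0; apply: val_inj; apply/funext => n /=.
have [k Ank] := kothe_coef_gt0 n.
have := coord_kothe_elt k x; rewrite (rnorm0_eq0 (x0 k)) linear0.
move=> /(congr1 (fun f => f n)) /esym/eqP.
by rewrite mulf_eq0 (negPf (of_real_neq0 Ank)) orbF => /eqP.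
Qed.

Lemma coord_bound (v : l) n : `|coord l v n| <= `|v|.
Proof.
have cvE : coord l (coord l v n *: unit_vector l n) =
           fun m => coord l v n * (m == n)%:R.
  by rewrite linearZ/= coord_unit_vector.
have := @norm_monotone _ _ l (coord l v n *: unit_vector l n) v.
rewrite normrZ norm_unit_vector mulr1; apply => m; rewrite cvE.
by have [->|] := eqVneq m n; rewrite ?mulr1// mulr0 normr0.
Qed.

Lemma coord_cvg (v : nat -> l) w n : v @ \oo --> w ->
  coord l (v m) n @[m --> \oo] --> (coord l w n : K^o).
Proof.
move=> /cvgrPdist_lt vw; apply/cvgrPdist_lt => e e0.
apply: filterS (vw e e0) => m; apply: le_lt_trans.
have -> : coord l w n - coord l (v m) n = coord l (w - v m) n.
  by rewrite linearB.
exact: coord_bound.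
Qed.

Lemma kothe_complete (u : nat -> kothe_space) : seminorm_cauchy kothe_norm u ->
  exists x, forall k, kothe_norm k (u n - x) @[n --> \oo] --> (0 : R).
Proof.
move=> cu.
have eltB k x y : kothe_elt k (x - y) = kothe_elt k x - kothe_elt k y.
  by rewrite kothe_eltD -scaleN1r kothe_eltZ scaleN1r.
have /choice[y uy] : forall k, exists y : l, kothe_elt k (u n) @[n --> \oo] --> y.
  move=> k; apply/cvg_ex/cauchy_cvgP/cauchy_exP => e e0.
  have eE : of_real s (real_part e) = e by rewrite ge0_of_real// ltW.
  have re0 : 0 < real_part e by rewrite -(of_real_lt s) rmorph0 eE.
  have [n0 un0] := cu k _ re0.
  exists (kothe_elt k (u n0)), n0 => //= n /= n0n.
  rewrite -ball_normE/= -eltB rnormE -eE of_real_lt.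
  exact: un0.
have /choice[kk kkP] := kothe_coef_gt0.
pose x n : K := coord l (y (kk n)) n / of_real s (A n (kk n)).
have yE k : coord l (y k) = weighted k x.
  apply/funext => n; rewrite /weighted /x mulrAC.
  apply: (canRL (mulfK (of_real_neq0 (kkP n)))).
  have c1 := coord_cvg (n := n) (uy k).
  have c2 := coord_cvg (n := n) (uy (kk n)).
  have c1' := cvgM c1 (cvg_cst (of_real s (A n (kk n)) : K^o)).
  have c2' := cvgM c2 (cvg_cst (of_real s (A n k) : K^o)).
  apply: (@cvg_unique _ (@norm_hausdorff K K^o) _ _ _ _ (c1' _ _)).
  apply: cvg_trans (c2' _ _); apply: near_eq_cvg; near=> m.
  have eltE j : coord l (kothe_elt j (u m)) n = u m n * of_real s (A n j).
    by rewrite coord_kothe_elt.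
  by rewrite /GRing.mul_fun /= !eltE mulrAC.
have xP : x \in kothe_pred by rewrite inE => k; exists (y k).
exists (KotheSpace xP) => k.
have yx : kothe_elt k (KotheSpace xP) = y k.
  by apply: (@coord_inj _ _ l); rewrite coord_kothe_elt yE.
apply/cvgrPdist_lt => e e0.
have /cvgrPdist_lt/(_ (of_real s e)) := uy k.
rewrite -(rmorph0 (of_real s)) of_real_lt => /(_ e0); apply: filterS => n.
rewrite sub0r normrN ger0_norm ?rnorm_ge0// /kothe_norm eltB yx.
by rewrite distrC rnormE of_real_lt.
Unshelve. all: by end_near. Qed.

HB.instance Definition _ := Lmodule_isFrechet.Build R s kothe_space
  kothe_normD kothe_normZ kothe_normS kothe_separating kothe_complete.

Lemma kothe_seminormE k (x : kothe_space) : seminorm k x = kothe_norm k x.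
Proof. by []. Qed.

End kothe_space.

(* Main.v *)
(** Necessity. If the estimate fails for some sequence N(k), the failure yields,
for every N, rank one operators S_n = a u(.) e_i and Q_n = b e_i'(.) e_j that are
smaller than 2^-n for the norms ||.||_{k,N(k)}, k <= n, while
||Q_n S_n||_{r(N),N} > n; here N = logn 2 n, so that each N is treated for
infinitely many n.  All sums of subseries of the S_n and of the Q_n converge to
continuous operators, and a Baire category argument on the space of pairs of
subsets of the index set produces two of them whose composition is unbounded
from ||.||_N to ||.||_{r(N)} for every N.

Sufficiency. Let T = Q S.  By the Grothendieck-Pietsch criterion, each k has a
q(k) with sum_i b_i^k / b_i^{q(k)} < oo.  Take N(k) with
||S||_{q(k),N(k)} < oo and ||Q||_{k,N(k)} < oo, and let u_i = e_i' S.  Then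
||u_i||_{N(k)} b_i^k = O(b_i^k / b_i^{q(k)}) and ||Q e_i||_k = O(b_i^{N(k)}), so
the estimate, multiplied by |e_j'(Q e_i)| and read in the norm of the second
sequence space over j, bounds ||u_i||_N ||Q e_i||_r by a summable sequence in i;
and T x = sum_i u_i(x) Q e_i. *)

From HB Require Import structures.
Require Import Defs.
From mathcomp Require Import all_boot all_order all_algebra.
From mathcomp Require Import all_classical all_reals all_analysis.
From mathcomp Require Import ring.
Import Order.TTheory GRing.Theory Num.Theory.
Import numFieldNormedType.Exports.
Local Open Scope classical_set_scope.
Local Open Scope ring_scope.

Set Implicit Arguments.
Unset Strict Implicit.
Unset Printing Implicit Defensive.

(* Baire's theorem in a countable power of a discrete space; [U n b t] plays the
   role of: the cylinder of the sequences agreeing with [b] below [t] lies in the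
   n-th dense open set. *)
Lemma seq_baire (T : Type) (t0 : T) (U : nat -> (nat -> T) -> nat -> Prop) :
  (forall n t a, exists t' b, [/\ (t < t')%N,
     forall m, (m < t)%N -> b m = a m & U n b t']) ->
  exists c, forall n, exists t b,
    (forall m, (m < t)%N -> c m = b m) /\ U n b t.
Proof.
move=> ext.
have /choice[f fP] : forall z : nat * nat * (nat -> T),
    exists w : nat * (nat -> T), [/\ (z.1.2 < w.1)%N,
     forall m, (m < z.1.2)%N -> w.2 m = z.2 m & U z.1.1 w.2 w.1].
  by move=> [[n t] a]; have [t' [b bP]] := ext n t a; exists (t', b).
pose g := fix g n := if n is n'.+1 then f (n', (g n').1, (g n').2)
                     else (0%N, fun=> t0).
have gS n : [/\ ((g n).1 < (g n.+1).1)%N,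
   forall m, (m < (g n).1)%N -> (g n.+1).2 m = (g n).2 m &
   U n (g n.+1).2 (g n.+1).1] by exact: (fP (n, _, _)).
have gn n : (n <= (g n).1)%N.
  by elim: n => // n IH; have [lt _ _] := gS n; exact: leq_ltn_trans IH lt.
have agree p n m : (m < (g n).1)%N -> (g (n + p)%N).2 m = (g n).2 m.
  move=> mn; elim: p => [|p IH]; first by rewrite addn0.
  rewrite addnS; have [_ -> //] := gS (n + p)%N.
  rewrite (leq_trans mn)//; elim: (p) => [|q IHq]; first by rewrite addn0.
  by rewrite addnS; have [/ltnW lt _ _] := gS (n + q)%N; exact: leq_trans IHq lt.
(* Entry [m] is frozen from stage [m.+1] on, since that stage has already fixed more than [m]
   entries; so the diagonal is the limit of the stages. *)
exists (fun m => (g m.+1).2 m) => n.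
exists (g n.+1).1, (g n.+1).2; split; last by have [] := gS n.
(* Stages [m.+1] and [n.+1] are compared through the common later stage [n.+1 + m]. *)
move=> m mn; rewrite -(agree m n.+1 m mn) -(agree n m.+1 m) ?gn//.
by have -> : (m.+1 + n = n.+1 + m)%N by rewrite addSnnS addnC.
Qed.

(** * Real-valued norms, seminorms and continuity of linear maps *)

Section rnorm.
Context (R : realType) (s : scalars).
Local Notation K := (scalar_field R s).

Lemma rnorm_sum (V : normedZmodType K) (I : Type) (r : seq I) (P : pred I)
    (f : I -> V) :
  rnorm (\sum_(i <- r | P i) f i) <= \sum_(i <- r | P i) rnorm (f i).
Proof.
elim/big_ind2 : _ => [|a b c d ab cd|//]; first by rewrite rnorm0.
by rewrite (le_trans (rnormD _ _))// lerD.
Qed.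

Lemma rnorm1 : rnorm (1 : K) = 1.
Proof. by rewrite -(rmorph1 (of_real s)) rnorm_of_real normr1. Qed.

End rnorm.

Section seminorms.
Context (R : realType) (s : scalars) (E : frechetType R s).
Local Notation K := (scalar_field R s).
Implicit Types x y : E.

Lemma seminorm0 k : seminorm k (0 : E) = 0.
Proof. by rewrite -(scale0r 0) seminormZ rnorm0 mul0r. Qed.

Lemma seminormN k x : seminorm k (- x) = seminorm k x.
Proof. by rewrite -scaleN1r seminormZ rnormN rnorm1 mul1r. Qed.

Lemma seminorm_ge0 k x : 0 <= seminorm k x.
Proof.
by have := seminormD k x (- x); rewrite subrr seminorm0 seminormN -mulr2n pmulrn_lge0.
Qed.

Lemma seminorm_mono k m x : (k <= m)%N -> seminorm k x <= seminorm m x.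
Proof.
move=> /subnK <-; elim: (m - k)%N => //= n IH.
by rewrite addSn (le_trans IH)// seminormS.
Qed.

Lemma seminormB k x y : seminorm k (x - y) <= seminorm k x + seminorm k y.
Proof. by rewrite -(seminormN k y) seminormD. Qed.

Lemma seminorm_distC k x y : seminorm k (x - y) = seminorm k (y - x).
Proof. by rewrite -seminormN opprB. Qed.

Lemma seminorm_sum k (I : Type) (r : seq I) (P : pred I) (f : I -> E) :
  seminorm k (\sum_(i <- r | P i) f i) <= \sum_(i <- r | P i) seminorm k (f i).
Proof.
elim/big_ind2 : _ => [|a b c d ab cd|//]; first by rewrite seminorm0.
by rewrite (le_trans (seminormD _ _ _))// lerD.
Qed.

Lemma seminorm_separating x : (forall k, seminorm k x = 0) -> x = 0.
Proof.
move=> x0; apply/esym/(@frechet_hausdorff _ _ E) => A B nA nB.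
exists x; split; last exact: nbhs_singleton.
have [k [e e0]] := (nbhs_seminormP _ _).1 nA.
by apply; rewrite subr0 x0.
Qed.

Lemma cvg_seminormP (u : nat -> E) x : u @ \oo --> x <->
  forall k (e : R), 0 < e ->
    exists n0, forall n, (n0 <= n)%N -> seminorm k (u n - x) < e.
Proof.
split=> [ux k e e0|ux A /nbhs_seminormP[k [e e0 eA]]].
  have nx : nbhs x [set y | seminorm k (y - x) < e].
    by apply/nbhs_seminormP; exists k, e.
  by have [n0 _ n0P] := ux _ nx; exists n0 => n /n0P.
have [n0 n0P] := ux k e e0.
by exists n0 => //= n /n0P; exact: eA.
Qed.

Lemma homogeneous_bound (p : E -> R) :
  (forall a x, p (a *: x) = rnorm a * p x) -> nbhs 0 [set x | p x < 1] ->
  exists N, exists2 M : R, 0 < M & forall x, p x <= M * seminorm N x.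
Proof.
move=> pZ /nbhs_seminormP[N [e e0 eP]]; exists N, e^-1; first by rewrite invr_gt0.
have {}eP y : seminorm N y < e -> p y < 1 by move=> ye; apply: eP; rewrite subr0.
move=> x; apply/ler_addgt0Pr => d d0.
(* The summand [d] keeps the scaling factor [t] positive even when the seminorm of [x] vanishes. *)
set t := e^-1 * seminorm N x + d.
have t0 : 0 < t by rewrite ltr_wpDl// mulr_ge0 ?invr_ge0 ?seminorm_ge0// ltW.
have := eP ((of_real s t)^-1 *: x).
rewrite seminormZ pZ -fmorphV rnorm_of_real gtr0_norm ?invr_gt0//.
rewrite ![t^-1 * _]mulrC !ltr_pdivrMr// mul1r => pt; apply/ltW/pt.
by rewrite -ltr_pdivrMl// /t ltrDl.
Qed.

End seminorms.

Section continuous_linear.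
Context (R : realType) (s : scalars) (E F : frechetType R s).
Local Notation K := (scalar_field R s).

Lemma continuous_linear_seminorm (f : {linear E -> F}) : continuous f ->
  forall k, exists N, exists2 M : R, 0 < M &
    forall x, seminorm k (f x) <= M * seminorm N x.
Proof.
move=> fc k; apply: (@homogeneous_bound _ _ _ (fun x => seminorm k (f x))).
  by move=> a x; rewrite linearZ/= seminormZ.
apply: (fc 0 [set y | seminorm k y < 1]).
rewrite linear0; apply/nbhs_seminormP; exists k, 1 => // y.
by rewrite subr0.
Qed.

Lemma linear_seminorm_continuous (f : {linear E -> F}) :
  (forall k, exists N, exists M : R,
    forall x, seminorm k (f x) <= M * seminorm N x) -> continuous f.
Proof.
move=> fb x A /nbhs_seminormP[k [e e0 eA]]; have [N [M fM]] := fb k.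
have M0 : 0 < `|M| + 1 by rewrite ltr_wpDl.
apply/nbhs_seminormP; exists N, (e / (`|M| + 1)).
  by rewrite divr_gt0.
move=> y; rewrite ltr_pdivlMr// mulrC => yx; apply: eA; rewrite -linearB.
apply: le_lt_trans yx; rewrite (le_trans (fM _))// ler_wpM2r ?seminorm_ge0//.
by rewrite (le_trans (ler_norm M))// lerDl.
Qed.

Lemma continuous_functional_seminorm (u : {linear E -> K^o}) : continuous u ->
  exists N, exists2 M : R, 0 < M &
    forall x, rnorm (u x) <= M * seminorm N x.
Proof.
move=> uc; apply: (@homogeneous_bound _ _ _ (fun x => rnorm (u x))).
  by move=> a x; rewrite linearZ/= rnormZ.
apply: (uc 0 [set y : K^o | rnorm y < 1]); rewrite linear0.
exists 1 => //= y /=; rewrite sub0r normrN rnormE.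
by rewrite -(rmorph1 (of_real s)) of_real_lt.
Qed.

Lemma functional_seminorm_continuous (u : {linear E -> K^o}) N (M : R) :
  (forall x, rnorm (u x) <= M * seminorm N x) -> continuous u.
Proof.
move=> uM x; apply/(@cvgrPdist_lt K K^o) => e e0.
have e0' : 0 < real_part e.
  by rewrite -(of_real_lt s) rmorph0 ge0_of_real// ltW.
have M0 : 0 < `|M| + 1 by rewrite ltr_wpDl.
apply/nbhs_seminormP; exists N, (real_part e / (`|M| + 1)).
  by rewrite divr_gt0.
move=> y; rewrite ltr_pdivlMr// mulrC => yx /=.
rewrite -linearB rnormE -[e]ge0_of_real ?(ltW e0)// of_real_lt.
apply: le_lt_trans yx; rewrite (le_trans (uM _))//.
rewrite seminorm_distC ler_wpM2r ?seminorm_ge0//.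
by rewrite (le_trans (ler_norm M))// lerDl.
Qed.

End continuous_linear.

(** * Geometric bounds and sums of operator series *)

Lemma half_pow_lt (R : realType) (e : R) : 0 < e -> exists t, 2^-1 ^+ t < e.
Proof.
move=> e0.
have /cvgrPdist_lt/(_ e e0)[t _ /(_ t (leqnn t))] : 2^-1 ^+ n @[n --> \oo] --> (0 : R).
  by apply: cvg_expr; rewrite ger0_norm ?invr_ge0// invf_lt1// ltr1n.
by rewrite sub0r normrN ger0_norm ?exprn_ge0 ?invr_ge0//; exists t.
Qed.

Lemma half_pow_anti (R : realType) t t' : (t <= t')%N ->
  2^-1 ^+ t' <= 2^-1 ^+ t :> R.
Proof. by move=> tt'; apply: ler_wiXn2l; rewrite ?invr_ge0// invf_le1// ler1n. Qed.

(** This replaces passages to the limit: the bounds available for the [k]-th seminorm start only at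
    [t = k]. *)
Lemma half_pow_le0 (R : realType) k (v c : R) :
  (forall t, (k <= t)%N -> v <= 2^-1 ^+ t * c) -> v <= 0.
Proof.
move=> vc; rewrite leNgt; apply/negP => v0.
have c0 : 0 < `|c| + 1 by rewrite ltr_wpDl.
have [t] := half_pow_lt (divr_gt0 v0 c0); rewrite ltr_pdivlMr// ltNge => /negP.
apply; rewrite (le_trans (vc _ (leq_maxl k t)))//.
apply: (@le_trans _ _ (2^-1 ^+ maxn k t * (`|c| + 1))).
  by rewrite ler_wpM2l ?exprn_ge0 ?invr_ge0// (le_trans (ler_norm c))// lerDl.
by rewrite ler_wpM2r ?(ltW c0)// half_pow_anti// leq_maxr.
Qed.

Lemma half_pow_sum (R : realType) t t' : 
  \sum_(t <= n < t') 2^-1 ^+ n <= 2 * 2^-1 ^+ t :> R.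
Proof.
have [tt'|/ltnW t't] := leqP t t'; last first.
  by rewrite big_geq// mulr_ge0// exprn_ge0 ?invr_ge0.
suff -> : \sum_(t <= n < t') 2^-1 ^+ n = 2 * 2^-1 ^+ t - 2 * 2^-1 ^+ t' :> R.
  by rewrite lerBlDr lerDl mulr_ge0// exprn_ge0 ?invr_ge0.
elim: t' tt' => [|t' IH]; first by rewrite leqn0 => /eqP->; rewrite big_nil subrr.
rewrite leq_eqVlt => /predU1P[->|]; first by rewrite big_geq// subrr.
rewrite ltnS => tt'; rewrite big_nat_recr//= IH// exprS mulrA divff// mul1r.
by rewrite -addrA; congr (_ + _); rewrite mulr2n mulrDl mul1r opprD subrK.
Qed.

Section operator_series.
Context (R : realType) (s : scalars) (E F : frechetType R s).
Variables (S : nat -> {linear E -> F}) (N_ : nat -> nat).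
Hypothesis Sc : forall n, continuous (S n).
Hypothesis Sle : forall k n x, (k <= n)%N ->
  seminorm k (S n x) <= 2^-1 ^+ n * seminorm (N_ k) x.

Lemma partial_sum_dist (th : pred nat) k t t' x : (k <= t)%N -> (t <= t')%N ->
  seminorm k (\sum_(0 <= n < t' | th n) S n x - \sum_(0 <= n < t | th n) S n x)
  <= 2^-1 ^+ t * (2 * seminorm (N_ k) x).
Proof.
move=> kt tt'; rewrite (big_cat_nat (n := t))//= addrAC subrr add0r.
rewrite (le_trans (seminorm_sum _ _ _ _))// mulrCA mulrA.
rewrite (le_trans _ (ler_wpM2r (seminorm_ge0 _ _) (half_pow_sum R t t')))//.
rewrite mulr_suml big_mkcond/= big_nat [leRHS]big_nat.
apply: ler_sum => n /andP[tn _]; case: ifP => _; last first.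
  by rewrite mulr_ge0 ?seminorm_ge0// exprn_ge0 ?invr_ge0.
by rewrite Sle// (leq_trans kt).
Qed.

(** The terms with index below [k] escape [Sle]; their own continuity bounds them, with an
    uncontrolled index [N]. *)
Lemma partial_sum_seminorm (th : pred nat) k t : exists N, exists M : R,
  forall x, seminorm k (\sum_(0 <= n < t | th n) S n x) <= M * seminorm N x.
Proof.
elim: t => [|t [N [M NM]]].
  by exists 0%N, 0 => x; rewrite big_nil seminorm0 mul0r.
have [N' [M' M'0 NM']] := continuous_linear_seminorm (@Sc t) k.
exists (maxn N N'), (`|M| + M') => x; rewrite big_mkcond big_nat_recr//= -big_mkcond/=.
rewrite (le_trans (seminormD _ _ _))// mulrDl lerD//.
  rewrite (le_trans (NM x))// (@le_trans _ _ (`|M| * seminorm N x))//.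
    by rewrite ler_wpM2r ?seminorm_ge0// ler_norm.
  by rewrite ler_wpM2l// seminorm_mono// leq_maxl.
apply: (@le_trans _ _ (M' * seminorm N' x)); last first.
  by rewrite ler_wpM2l ?(ltW M'0)// seminorm_mono// leq_maxr.
by case: ifP => _ //; rewrite seminorm0 mulr_ge0 ?seminorm_ge0// ltW.
Qed.

(** The pointwise sums exist by completeness. The explicit rate, uniform in the selection [th],
    later makes the sum depend continuously on [th]. *)
Lemma operator_series (th : pred nat) : exists2 T : {linear E -> F},
  continuous T & forall k t x, (k <= t)%N ->
    seminorm k (T x - \sum_(0 <= n < t | th n) S n x)
      <= 2^-1 ^+ t * (2 * seminorm (N_ k) x).
Proof.
pose P t x := \sum_(0 <= n < t | th n) S n x.
have /choice[f fP] : forall x, exists y : F, P t x @[t --> \oo] --> y.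
  move=> x; apply: frechet_complete => k e e0.
  have c0 : 0 < 2 * (2 * seminorm (N_ k) x) + 1.
    by rewrite ltr_wpDl// !mulr_ge0// seminorm_ge0.
  have [t] := half_pow_lt (divr_gt0 e0 c0); rewrite ltr_pdivlMr// => te.
  exists (maxn k t) => m n km kn; apply: le_lt_trans te.
  (* Both sums are compared with the one at [maxn k t], from which on the geometric bound holds. *)
  have -> : P m x - P n x = (P m x - P (maxn k t) x) - (P n x - P (maxn k t) x).
    by rewrite opprB addrA subrK.
  have half := half_pow_anti R (leq_maxr k t).
  have c1 : 0 <= 2 * seminorm (N_ k) x by rewrite mulr_ge0// seminorm_ge0.
  rewrite (le_trans (seminormB _ _ _))// mulrDr mulr1 mulrCA mulr2n (mulrDl 1 1) !mul1r.
  rewrite -[leLHS]addr0 !lerD// ?exprn_ge0 ?invr_ge0//.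
    by rewrite (le_trans (partial_sum_dist _ _ _ km)) ?leq_maxl// ler_wpM2r.
  by rewrite (le_trans (partial_sum_dist _ _ _ kn)) ?leq_maxl// ler_wpM2r.
have fle k t x : (k <= t)%N ->
    seminorm k (f x - P t x) <= 2^-1 ^+ t * (2 * seminorm (N_ k) x).
  move=> kt; apply/ler_addgt0Pr => e e0.
  have [n0 n0P] := (cvg_seminormP _ _).1 (fP x) k e e0.
  have -> : f x - P t x = (P (maxn n0 t) x - P t x) - (P (maxn n0 t) x - f x).
    by rewrite opprB addrACA addrC addrA subrK addrC.
  rewrite (le_trans (seminormB _ _ _))// lerD//.
    by rewrite partial_sum_dist// leq_maxr.
  by rewrite ltW// n0P// leq_maxl.
have Plin t a x y : P t (a *: x + y) = a *: P t x + P t y.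
  rewrite /P scaler_sumr -big_split/=.
  by apply: eq_bigr => n _; rewrite linearP.
have flin : linear f.
  move=> a x y; apply/eqP; rewrite -subr_eq0; apply/eqP/seminorm_separating => k.
  apply/eqP; rewrite eq_le seminorm_ge0 andbT.
  apply: (@half_pow_le0 _ k _ (2 * seminorm (N_ k) (a *: x + y) +
    (rnorm a * (2 * seminorm (N_ k) x) + 2 * seminorm (N_ k) y))) => t kt.
  (* The partial sums are linear, so the defect of linearity is only made of three tails of order
     [2^-t]. *)
  have -> : f (a *: x + y) - (a *: f x + f y) = (f (a *: x + y) - P t (a *: x + y)) -
      (a *: (f x - P t x) + (f y - P t y)).
    by rewrite scalerBr addrACA -opprD -Plin opprB addrA subrK.
  rewrite (le_trans (seminormB _ _ _))// mulrDr lerD//; first exact: fle.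
  rewrite (le_trans (seminormD _ _ _))// mulrDr lerD//; last exact: fle.
  by rewrite seminormZ mulrCA ler_wpM2l ?rnorm_ge0// fle.
pose T : {linear E -> F} := HB.pack f (GRing.isLinear.Build _ _ _ _ f flin).
exists T; last exact: fle.
apply: linear_seminorm_continuous => k.
have [N [M NM]] := partial_sum_seminorm th k k.
exists (maxn N (N_ k)), (`|M| + 2^-1 ^+ k * 2) => x.
rewrite -[T x](subrK (P k x)) addrC (le_trans (seminormD _ _ _))// mulrDl lerD//.
  rewrite (le_trans (NM x))// (@le_trans _ _ (`|M| * seminorm N x))//.
    by rewrite ler_wpM2r ?seminorm_ge0// ler_norm.
  by rewrite ler_wpM2l// seminorm_mono// leq_maxl.
rewrite (le_trans (fle k k x _))// -mulrA !ler_wpM2l ?exprn_ge0 ?invr_ge0//.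
by rewrite seminorm_mono// leq_maxr.
Qed.

End operator_series.

(** * Rank one operators and operator norms *)

Section rank_one.
Context (R : realType) (s : scalars) (E F : frechetType R s).
Local Notation K := (scalar_field R s).
Implicit Types (u : {linear E -> K^o}) (f : F).

Definition rank_one (u : {linear E -> K^o}) (f : F) : E -> F := fun x => u x *: f.

Lemma rank_one_linear u f : linear (rank_one u f).
Proof. by move=> a x y; rewrite /rank_one linearP/= scalerDl scalerA. Qed.

HB.instance Definition _ u f :=
  GRing.isLinear.Build _ _ _ _ (rank_one u f) (rank_one_linear u f).

Lemma rank_one_seminorm u f k x :
  seminorm k (rank_one u f x) = rnorm (u x) * seminorm k f.
Proof. exact: seminormZ. Qed.

Lemma rank_one_continuous u f : continuous u -> continuous (rank_one u f).
Proof.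
move=> /continuous_functional_seminorm[N [M M0 uM]].
apply: linear_seminorm_continuous => k; exists N, (seminorm k f * M) => x.
by rewrite rank_one_seminorm mulrC -mulrA ler_wpM2l ?seminorm_ge0.
Qed.

End rank_one.

Section homogeneous_opnorm.
Context (R : realType) (s : scalars) (V : lmodType (scalar_field R s)).
Local Notation K := (scalar_field R s).
Variable p : V -> R.
Hypothesis pZ : forall a x, p (a *: x) = rnorm a * p x.
Hypothesis p_ge0 : forall x, 0 <= p x.

Lemma opnorm_ge0 (W : Type) (q : W -> R) (T : V -> W) :
  (forall y, 0 <= q y) -> (0 <= opnorm p q T)%E.
Proof.
move=> q0; apply: ereal_sup_ge; exists (q (T 0))%:E; last by rewrite lee_fin.
by exists 0 => //=; rewrite -(scale0r 0) pZ rnorm0 mul0r.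
Qed.

Lemma opnorm_le (W : Type) (q : W -> R) (T : V -> W) (M : R) :
  (forall x, p x <= 1 -> q (T x) <= M) -> (opnorm p q T <= M%:E)%E.
Proof. by move=> TM; apply: ge_ereal_sup => _ [x /TM ? <-]; rewrite lee_fin. Qed.

Lemma le_opnorm (W : Type) (q : W -> R) (T : V -> W) x : p x <= 1 ->
  ((q (T x))%:E <= opnorm p q T)%E.
Proof. by move=> x1; apply: ereal_sup_ubound; exists x. Qed.

Lemma functional_opnorm_bound (u : {linear V -> K^o}) (M : R) :
  (opnorm p (@rnorm R s K^o) u <= M%:E)%E -> forall x, rnorm (u x) <= M * p x.
Proof.
move=> uM x.
have M0 : 0 <= M.
  by rewrite -lee_fin (le_trans _ uM)// opnorm_ge0//; exact: rnorm_ge0.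
(* Any positive [t] above [p x] may serve for the normalization, so vectors in the kernel of [p] are
   reached by letting [t] tend to 0. *)
have scaled (t : R) : 0 < t -> p x <= t -> rnorm (u x) <= M * t.
  move=> t0 xt; have := @le_opnorm K^o (@rnorm R s K^o) u ((of_real s t)^-1 *: x).
  rewrite linearZ/= pZ rnormM -fmorphV rnorm_of_real gtr0_norm ?invr_gt0//.
  rewrite mulrC ler_pdivrMr// mul1r => /(_ xt)/le_trans/(_ uM).
  by rewrite lee_fin mulrC ler_pdivrMr.
have [x0|x0] := eqVneq (p x) 0; last first.
  by apply: scaled; rewrite // lt_neqAle eq_sym x0 p_ge0.
rewrite x0 mulr0; apply/ler_addgt0Pr => e e0.
have := scaled (e / (M + 1)); rewrite x0 => /(_ _ _)/le_trans; apply.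
- by rewrite divr_gt0// ltr_wpDl.
- by rewrite divr_ge0 ?addr_ge0// ltW.
- by rewrite add0r mulrCA ler_piMr ?(ltW e0)// ler_pdivrMr ?mul1r ?lerDl// ltr_wpDl.
Qed.

End homogeneous_opnorm.

Local Notation coord := Defs.coord.

(** * Coordinates and norms in Banach sequence spaces *)

Section lambda_space.
Context (R : realType) (s : scalars) (l : lambda_space R s).
Local Notation K := (scalar_field R s).

Lemma coord_bigsum (I : Type) (r : seq I) (P : pred I) (f : I -> l) m :
  coord l (\sum_(i <- r | P i) f i) m = \sum_(i <- r | P i) coord l (f i) m.
Proof.
rewrite linear_sum; elim/big_rec2 : _ => // i a b _ <-.
by [].
Qed.

Lemma coord_section n (a : nat -> K) m :
  coord l (\sum_(0 <= i < n) a i *: unit_vector l i) m = if (m < n)%N then a m else 0.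
Proof.
rewrite coord_bigsum.
have -> : (\sum_(0 <= i < n) coord l (a i *: unit_vector l i) m =
          \sum_(0 <= i < n) if i == m then a i else 0)%R.
  apply: eq_bigr => i _; rewrite linearZ/= coord_unit_vector.
  rewrite -[LHS]/(a i * (m == i)%:R).
  by rewrite eq_sym; case: ifP => _; rewrite ?mulr1 ?mulr0.
rewrite -big_mkcond/= big_mkord; case: ifPn => [mn|].
  rewrite (big_pred1 (Ordinal mn))// => i.
rewrite -leqNgt => nm; rewrite big1// => i /eqP im.
by have := ltn_ord i; rewrite im ltnNge nm.
Qed.

(** Coordinates are continuous, and the [m]-th coordinate of the partial sums of the basis expansion
    is constant from [m.+1] on; so the basis coefficients are the coordinates. *)
Lemma coord_expansion (v : l) :
  series (fun n => coord l v n *: unit_vector l n) @ \oo --> v.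
Proof.
have [a [av _]] := (@unit_vector_basis _ _ l).1 v.
suff -> : coord l v = a by [].
apply/funext => m.
have c1 := coord_cvg (n := m) av.
have c2 : coord l (series (fun n => a n *: unit_vector l n) n) m @[n --> \oo]
    --> (a m : K^o).
  apply: cvg_near_cst; exists m.+1 => //= n /= mn.
  by rewrite /series/= coord_section mn.
exact: (@cvg_unique _ (@norm_hausdorff K K^o) _ _ _ _ c1 c2).
Qed.

Lemma lambda_norm_le (v : l) (M : R) :
  (forall n, rnorm (\sum_(0 <= i < n) coord l v i *: unit_vector l i) <= M) ->
  rnorm v <= M.
Proof.
move=> vM; apply/ler_addgt0Pr => e e0.
have /cvgrPdist_lt/(_ (of_real s e)) := coord_expansion (v := v).
rewrite -(rmorph0 (of_real s)) of_real_lt => /(_ e0)[n _ /(_ n (leqnn n))].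
rewrite rnormE of_real_lt => /ltW ve.
by rewrite -(subrK (series (fun n => coord l v n *: unit_vector l n) n) v) addrC
  (le_trans (rnormD _ _))// lerD// vM.
Qed.

Lemma rnorm_monotone (x y : l) :
  (forall n, rnorm (coord l x n) <= rnorm (coord l y n)) -> rnorm x <= rnorm y.
Proof.
by move=> xy; rewrite rnorm_le norm_monotone// => n; rewrite -rnorm_le.
Qed.

(* Solidity of the norm without solidity of the space: [v] is split, up to any
   finite section, into pieces dominated by the [w k]. *)
Lemma lambda_norm_le_sum (v : l) p (w : nat -> l) :
  (forall n, rnorm (coord l v n) <= \sum_(k < p) rnorm (coord l (w k) n)) ->
  rnorm v <= \sum_(k < p) rnorm (w k).
Proof.
move=> vw; apply: lambda_norm_le => n.
pose W i := \sum_(k < p) rnorm (coord l (w k) i).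
(* Each coordinate of [v] is shared among the [w k] in proportion to their moduli; where [W i] is 0,
   so is the coordinate of [v]. *)
pose a k i : K := coord l v i * of_real s (rnorm (coord l (w k) i) / W i).
have W0 i : 0 <= W i by apply: sumr_ge0 => k _; exact: rnorm_ge0.
have aE i : coord l v i = \sum_(k < p) a k i.
  have [Wi|Wi] := eqVneq (W i) 0.
    have v0 : coord l v i = 0.
      by apply: rnorm0_eq0; apply/eqP; rewrite eq_le rnorm_ge0 andbT -Wi vw.
    by rewrite big1// => k _; rewrite /a v0 mul0r.
  by rewrite -mulr_sumr -rmorph_sum -mulr_suml /= divff// rmorph1 mulr1.
have -> : \sum_(0 <= i < n) coord l v i *: unit_vector l i =
    \sum_(k < p) \sum_(0 <= i < n) a k i *: unit_vector l i.
  rewrite exchange_big; apply: eq_bigr => i _.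
  by rewrite [in LHS]aE scaler_suml.
rewrite (le_trans (rnorm_sum _ _ _))// ler_sum// => k _.
apply: rnorm_monotone => m; rewrite coord_section; case: ifP => _; last first.
  by rewrite rnorm0 rnorm_ge0.
have [Wm|Wm] := eqVneq (W m) 0.
  by rewrite /a Wm invr0 mulr0 rmorph0 mulr0 rnorm0 rnorm_ge0.
rewrite /a rnormM rnorm_of_real ger0_norm ?divr_ge0 ?rnorm_ge0//.
rewrite mulrA ler_pdivrMr ?lt_neqAle 1?eq_sym ?Wm ?W0// mulrC.
by rewrite ler_wpM2l ?rnorm_ge0// vw.
Qed.

End lambda_space.

(** * Unit vectors and coordinate functionals of Köthe spaces *)

Section kothe_space.
Context (R : realType) (s : scalars) (l : lambda_space R s) (A : kothe_matrix R).
Local Notation K := (scalar_field R s).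
Local Notation X := (kothe_space l A).

Lemma kothe_unit_subproof j : (fun m => (m == j)%:R : K) \in kothe_pred l A.
Proof.
rewrite inE => k; exists (of_real s (A j k) *: unit_vector l j) => //.
rewrite linearZ/= coord_unit_vector; apply/funext => m; rewrite /weighted.
rewrite -[LHS]/(of_real s (A j k) * (m == j)%:R) mulrC.
by have [->//|_] := eqVneq m j; rewrite !mul0r.
Qed.

Definition kothe_unit j : X := KotheSpace (kothe_unit_subproof j).

Lemma kothe_unitE j m : kothe_unit j m = (m == j)%:R.
Proof. by []. Qed.

Lemma kothe_elt_unit j k :
  kothe_elt k (kothe_unit j) = of_real s (A j k) *: unit_vector l j.
Proof.
apply: (@coord_inj _ _ l); rewrite coord_kothe_elt linearZ/= coord_unit_vector.
apply/funext => m; rewrite /weighted/=.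
rewrite -[RHS]/(of_real s (A j k) * (m == j)%:R) mulrC.
by have [->//|_] := eqVneq m j; rewrite !mulr0.
Qed.

Lemma seminorm_kothe_unit j k : seminorm k (kothe_unit j) = A j k.
Proof.
rewrite kothe_seminormE /kothe_norm kothe_elt_unit rnormZ rnorm_of_real.
rewrite /rnorm norm_unit_vector -(rmorph1 (of_real s)) real_part_of_real mulr1.
by rewrite ger0_norm// kothe_ge0.
Qed.

Definition kothe_coord i : X -> K^o := fun y => y i.

Lemma kothe_coord_linear i : linear (kothe_coord i).
Proof. by []. Qed.

HB.instance Definition _ i :=
  GRing.isLinear.Build _ _ _ _ (kothe_coord i) (kothe_coord_linear i).

Lemma kothe_coord_le i k (y : X) :
  rnorm (kothe_coord i y) * A i k <= seminorm k y.
Proof.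
rewrite -{1}[A i k]ger0_norm ?kothe_ge0// -(rnorm_of_real s).
rewrite -(rnormM (kothe_coord i y) _ : _ = rnorm (_ : K) * _) rnorm_le.
have := coord_bound (kothe_elt k y) i.
by rewrite coord_kothe_elt.
Qed.

Lemma rnorm_kothe_coord_unit i : rnorm (kothe_coord i (kothe_unit i)) = 1.
Proof. by rewrite /kothe_coord kothe_unitE eqxx; exact: rnorm1. Qed.

Lemma kothe_coord_continuous i : continuous (kothe_coord i).
Proof.
have [k Aik] := kothe_coef_gt0 A i.
apply: (@functional_seminorm_continuous _ _ _ _ k (A i k)^-1) => y.
by rewrite mulrC ler_pdivlMr// kothe_coord_le.
Qed.

HB.instance Definition _ k :=
  GRing.isLinear.Build _ _ _ _ (@kothe_elt _ _ l A k) (@kothe_elt_linear _ _ l A k).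

Lemma kothe_elt_span k n (a : nat -> K) :
  kothe_elt k (\sum_(0 <= i < n) a i *: kothe_unit i) =
  \sum_(0 <= i < n) (a i * of_real s (A i k)) *: unit_vector l i.
Proof.
rewrite linear_sum; apply: eq_bigr => i _.
by rewrite linearZ/= kothe_elt_unit scalerA.
Qed.

(** For each [k], [kothe_elt k] carries these sums to the sections of [kothe_elt k y], which
    converge by the basis property. *)
Lemma kothe_expansion (y : X) :
  (\sum_(0 <= i < n) kothe_coord i y *: kothe_unit i) @[n --> \oo] --> y.
Proof.
apply/cvg_seminormP => k e e0.
have /cvgrPdist_lt/(_ (of_real s e)) := coord_expansion (v := kothe_elt k y).
rewrite -(rmorph0 (of_real s)) of_real_lt => /(_ e0)[n _ nP].
exists n => m /nP; rewrite rnormE of_real_lt seminorm_distC.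
rewrite kothe_seminormE /kothe_norm linearB/= (kothe_elt_span k m (fun i => kothe_coord i y)).
by congr (rnorm (_ - _) < _); apply: eq_bigr => i _; rewrite coord_kothe_elt.
Qed.

End kothe_space.

(** * The Grothendieck-Pietsch criterion *)

Section grothendieck_pietsch.
Context (R : realType) (s : scalars) (l : lambda_space R s) (A : kothe_matrix R).
Local Notation K := (scalar_field R s).
Local Notation X := (kothe_space l A).

(* Choosing the phases of the coefficients turns the left-hand side into the
   value of [v] at a single vector, whose norm is controlled by monotonicity. *)
Lemma diagonal_sum_le p q (v : {linear X -> K^o}) (nu : R) m (x : X) :
  0 <= nu -> (forall z, rnorm (v z) <= nu * seminorm q z) ->
  \sum_(0 <= i < m) rnorm (v (kothe_unit l A i)) / A i q * (rnorm (kothe_coord i x) * A i p)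
    <= nu * seminorm p x.
Proof.
move=> nu0 vnu.
pose w i : K := v (kothe_unit l A i).
pose b i : R := (rnorm (kothe_coord i x) * A i p) / A i q.
have b0 i : 0 <= b i by rewrite !mulr_ge0 ?invr_ge0 ?kothe_ge0 ?rnorm_ge0.
pose a i : K := of_real s (rnorm (w i)) / w i * of_real s (b i).
pose z : X := \sum_(0 <= i < m) a i *: kothe_unit l A i.
have -> : \sum_(0 <= i < m) rnorm (v (kothe_unit l A i)) / A i q *
    (rnorm (kothe_coord i x) * A i p) = rnorm (v z).
  have -> : v z = of_real s (\sum_(0 <= i < m) rnorm (w i) * b i) :> K.
    rewrite linear_sum rmorph_sum; apply: eq_bigr => i _.
    rewrite linearZ /= -[LHS]/(a i * w i) rmorphM/= /a mulrAC; congr (_ * _).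
    have [->|wi] := eqVneq (w i) 0; first by rewrite mulr0 rnorm0 rmorph0.
    by rewrite divfK.
  rewrite rnorm_of_real ger0_norm; last first.
    by apply: sumr_ge0 => i _; rewrite mulr_ge0// rnorm_ge0.
  by apply: eq_bigr => i _; rewrite -[LHS]mulrA [_^-1 * _]mulrC.
rewrite (le_trans (vnu z))// ler_wpM2l// !kothe_seminormE /kothe_norm.
(* Coordinatewise, [z] weighted at level [q] is dominated by [x] weighted at level [p]; if [A i q]
   is 0 the left side vanishes. *)
apply: rnorm_monotone => i; rewrite (kothe_elt_span l A q m a).
rewrite coord_section.
case: ifP => _; last by rewrite rnorm0 rnorm_ge0.
have phase : rnorm (of_real s (rnorm (w i)) / w i : K) <= 1.
  have [->|wi] := eqVneq (w i) 0; first by rewrite invr0 mulr0 rnorm0.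
  rewrite -(@rnorm1 R s) rnorm_le -rnormE normf_div normr_id divff ?normr_eq0//.
  by rewrite normr1.
rewrite coord_kothe_elt /weighted /a (rnormM (_ * _ * _)) (rnormM (_ * _)).
rewrite (rnormM (x i)) !rnorm_of_real.
rewrite !ger0_norm ?kothe_ge0// -mulrA -[leRHS]mul1r.
rewrite ler_pM ?rnorm_ge0 ?(mulr_ge0 (b0 i)) ?kothe_ge0// /b.
have [->|q0] := eqVneq (A i q) 0; first by rewrite mulr0 mulr_ge0 ?rnorm_ge0 ?kothe_ge0.
by rewrite divfK.
Qed.

(* The vectors [y n] of the nuclear representation are approximated by elements
   [jp (x n)], on which the coordinate functionals are defined; this avoids
   extending them to the local Banach space. *)
Lemma nuclear_kothe_summable : nuclear X -> forall p, exists2 q, (p <= q)%N &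
  exists V : R, forall m, \sum_(0 <= i < m) A i p / A i q <= V.
Proof.
move=> nX p; have [q pq [Xp [Xq [jp [jq [T]]]]]] := nX p.
move=> [[jpE jp_dense] [jqE _] _ Tj [u [y [_ fin_sum Ty]]]].
exists q => //.
set c := fun n => (opnorm (@rnorm R s Xq) (@rnorm R s K) (u n) * (rnorm (y n))%:E)%E.
have op0 n : (0 <= opnorm (@rnorm R s Xq) (@rnorm R s K) (u n))%E.
  by apply: opnorm_ge0 => *; rewrite ?rnorm_ge0// rnormZ.
have c0 n : (0 <= c n)%E by rewrite mule_ge0// lee_fin rnorm_ge0.
pose V := fine (\sum_(0 <= n <oo) c n)%E; exists V.
have VE : (\sum_(0 <= n <oo) c n)%E = V%:E.
  by rewrite fineK// ge0_fin_numE// nneseries_ge0.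
(* The finite sum makes the norm of [u n] finite only if [y n] is nonzero. Otherwise [nu n] is 0 and
   nothing is claimed about [u n]. *)
have /choice[nu nuP] : forall n, exists nu : R, [/\ 0 <= nu, y n != 0 ->
    forall z, rnorm (u n z) <= nu * rnorm z & (nu * rnorm (y n))%:E = c n].
  move=> n; have [yn|yn] := eqVneq (y n) 0.
    by exists 0; split => //; rewrite /c yn rnorm0 mulr0 mule0.
  have yn0 : 0 < rnorm (y n).
    rewrite lt_neqAle rnorm_ge0 andbT; apply: contra_neq yn => /esym.
    exact: rnorm0_eq0.
  have opE : opnorm (@rnorm R s Xq) (@rnorm R s K) (u n) \is a fin_num.
    rewrite ge0_fin_numE//; have : (c n < +oo)%E.
      rewrite (le_lt_trans _ fin_sum)//.
      apply: le_trans (@nneseries_lim_ge _ c xpredT 0 n.+1 _); last by move=> *; exact: c0.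
      by rewrite big_nat_recr//= leeDr// sume_ge0.
    rewrite /c; move: (op0 n); case: (opnorm _ _ _) => //= [r _ _|_].
      by rewrite ltry.
    by rewrite gt0_mulye.
  exists (fine (opnorm (@rnorm R s Xq) (@rnorm R s K) (u n))); split.
  - by rewrite fine_ge0.
  - move=> _; apply: functional_opnorm_bound.
    + by move=> a z; rewrite rnormZ.
    + by move=> z; rewrite rnorm_ge0.
    + by rewrite fineK.
  - by rewrite EFinM fineK.
have cV t : \sum_(0 <= n < t) nu n * rnorm (y n) <= V.
  rewrite -lee_fin -VE -sumEFin.
  apply: le_trans (@nneseries_lim_ge _ c xpredT 0 t _); last by move=> *; exact: c0.
  by apply: lee_sum => n _; have [_ _ ->] := nuP n.
(* Unit vectors normalized for the seminorm [q]; if [A i q] is 0, both [g i] and the quotient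
   [A i p / A i q] are 0. *)
pose g i : X := of_real s (A i q)^-1 *: kothe_unit l A i.
have gq i : seminorm q (g i) <= 1.
  rewrite seminormZ seminorm_kothe_unit rnorm_of_real ger0_norm ?invr_ge0 ?kothe_ge0//.
  by have [->|q0] := eqVneq (A i q) 0; rewrite ?mulr0// mulVf.
have gE i : rnorm (kothe_coord i (g i)) * A i p = A i p / A i q.
  rewrite mulrC /g linearZ/= rnormM rnorm_of_real.
  rewrite (rnorm_kothe_coord_unit l A) mulr1.
  by rewrite ger0_norm// invr_ge0 kothe_ge0.
pose P t i : Xp := \sum_(0 <= n < t) u n (jq (g i)) *: y n.
have Pcvg e m : 0 < e -> exists t0, forall t i, (t0 <= t)%N -> (i < m)%N ->
    rnorm (jp (g i) - P t i) <= e.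
  move=> e0; elim: m => [|m [t0 IH]]; first by exists 0%N.
  have /cvgrPdist_lt/(_ (of_real s e)) := Ty (jq (g m)).
  rewrite -(rmorph0 (of_real s)) of_real_lt => /(_ e0)[t1 _ t1P].
  exists (maxn t0 t1) => t i; rewrite geq_max => /andP[t0t t1t].
  rewrite ltnS leq_eqVlt => /predU1P[->|]; last exact: IH.
  have -> : jp (g m) = T (jq (g m)) by rewrite -[RHS]/((T \o jq) _) Tj.
  rewrite -(of_real_le s) -rnormE ltW//.
  exact: (t1P t t1t).
move=> m; apply/ler_addgt0Pr => e e0.
have e'0 : 0 < e / m.+1%:R by rewrite divr_gt0.
have [t /(_ t _ (leqnn t)) tP] := Pcvg _ m e'0.
set nus := \sum_(0 <= n < t) nu n.
have nus0 : 0 <= nus by apply: sumr_ge0 => n _; have [] := nuP n.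
(* The error [d * nus] will occur [m.+1] times: once for each of the [m] indices and once when the
   norms of the [x n] are replaced by those of the [y n]. Together these cost one share [e / m.+1];
   the other [m] shares pay for truncating the nuclear series. *)
pose d := e / m.+1%:R / (m.+1%:R * (nus + 1)).
have nus1 : 0 < nus + 1 by rewrite ltr_wpDl.
have d0 : 0 < d by rewrite divr_gt0// mulr_gt0.
have dnus : m.+1%:R * (d * nus) <= e / m.+1%:R.
  rewrite mulrCA /d mulrAC ler_pdivrMr ?mulr_gt0// ler_wpM2l ?(ltW e'0)//.
  by rewrite ler_wpM2l// lerDl.
(* Taking [x n] to be 0 along with [y n] removes the functionals that have no bound. *)
have /choice[x xP] : forall n, exists x : X,
    (y n = 0 -> x = 0) /\ rnorm (y n - jp x) <= d.
  move=> n; have [yn|yn] := eqVneq (y n) 0.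
    by exists 0; rewrite linear0 yn subr0 rnorm0 ltW.
  have od : 0 < of_real s d by rewrite -(rmorph0 (of_real s)) of_real_lt.
  have := jp_dense (interior (ball (y n) (of_real s d))).
  case; first by exists (y n); apply: nbhsx_ballx.
    exact: open_interior.
  move=> z [/interior_subset zd [x _ xz]]; move: zd; rewrite -xz => xd.
  exists x; split; first by move=> yn0; rewrite yn0 eqxx in yn.
  by rewrite -(of_real_le s) -rnormE ltW//; move: xd; rewrite -ball_normE.
have unu n i : y n != 0 -> rnorm (u n (jq (g i))) <= nu n.
  have [nu0 nuy _] := nuP n => /nuy/(_ (jq (g i)))/le_trans; apply.
  by rewrite jqE ler_piMr.
pose Q i : X := \sum_(0 <= n < t) u n (jq (g i)) *: x n.
have gQ i : (i < m)%N -> seminorm p (g i - Q i) <= e / m.+1%:R + d * nus.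
  move=> im; rewrite -jpE.
  have -> : jp (g i - Q i) = (jp (g i) - P t i) +
      \sum_(0 <= n < t) u n (jq (g i)) *: (y n - jp (x n)).
    rewrite linearB/= -addrA; congr (_ + _).
    rewrite /Q /P linear_sum -!sumrN -big_split/=; apply: eq_bigr => n _.
    by rewrite linearZ/= scalerBr addrA addNr add0r.
  rewrite (le_trans (rnormD _ _))// lerD ?tP//.
  rewrite (le_trans (rnorm_sum _ _ _))// mulrC mulr_suml ler_sum// => n _.
  have [yn|yn] := eqVneq (y n) 0.
    rewrite yn (xP n).1// linear0 subr0 scaler0 rnorm0 mulr_ge0 ?(ltW d0)//.
    by have [] := nuP n.
  by rewrite rnormZ ler_pM ?rnorm_ge0 ?unu ?(xP n).2.
have jqnu n z : y n != 0 -> rnorm (u n (jq z)) <= nu n * seminorm q z.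
  by rewrite -jqE; have [_ + _] := nuP n => /[apply]; apply.
have term n : \sum_(0 <= i < m) rnorm (u n (jq (g i))) *
    (rnorm (kothe_coord i (x n)) * A i p) <= nu n * (rnorm (y n) + d).
  have [nu0 nuy _] := nuP n.
  have [yn|yn] := eqVneq (y n) 0.
    rewrite (xP n).1// big1 ?mulr_ge0 ?addr_ge0 ?rnorm_ge0 ?(ltW d0)// => i _.
    by rewrite linear0 rnorm0 mul0r mulr0.
  apply: (@le_trans _ _ (nu n * seminorm p (x n))); last first.
    rewrite ler_wpM2l// -jpE -(subrK (y n) (jp (x n))) addrC.
    by rewrite (le_trans (rnormD _ _))// lerD2l -rnormN opprB (xP n).2.
  have := @diagonal_sum_le p q (u n \o jq) (nu n) m (x n) nu0 (fun z => jqnu n z yn).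
  apply: le_trans; rewrite le_eqVlt; apply/predU1P; left.
  apply: eq_bigr => i _; congr (_ * _).
  rewrite /g !linearZ/= rnormM mulrC rnorm_of_real ger0_norm//.
  by rewrite invr_ge0 kothe_ge0.
(* The quotient is the weighted [i]-th coordinate of [g i], which is split into the error
   [g i - Q i] and the finite rank part [Q i]; summing the latter over [i] gives the diagonal sums
   bounded in [term]. *)
have coordQ i : (i < m)%N -> A i p / A i q <= (e / m.+1%:R + d * nus) +
   \sum_(0 <= n < t) rnorm (u n (jq (g i))) * (rnorm (kothe_coord i (x n)) * A i p).
  move=> im; rewrite -gE -{1}[g i](subrK (Q i)) linearD.
  rewrite (le_trans (ler_wpM2r _ (rnormD _ _))) ?kothe_ge0// mulrDl lerD//.
    by rewrite (le_trans (kothe_coord_le _ _ _))// gQ.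
  rewrite /Q linear_sum (le_trans (ler_wpM2r _ (rnorm_sum _ _ _))) ?kothe_ge0//.
  rewrite mulr_suml ler_sum// => n _.
  by rewrite linearZ/= rnormM mulrA.
apply: (@le_trans _ _ (\sum_(0 <= i < m) ((e / m.+1%:R + d * nus) +
   \sum_(0 <= n < t) rnorm (u n (jq (g i))) *
     (rnorm (kothe_coord i (x n)) * A i p)))).
  by rewrite big_nat [leRHS]big_nat; apply: ler_sum => i /andP[_]; exact: coordQ.
rewrite big_split/= sumr_const_nat subn0 exchange_big/=.
rewrite (le_trans (lerD (lexx _) (ler_sum _ (fun n _ => term n))))//.
have -> : \sum_(0 <= n < t) nu n * (rnorm (y n) + d) =
    \sum_(0 <= n < t) nu n * rnorm (y n) + d * nus.
  by rewrite mulrC mulr_suml -big_split/=; apply: eq_bigr => n _; rewrite mulrDr.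
rewrite addrCA lerD// mulrnDl -addrA -mulrSr -[X in _ + X]mulr_natl.
apply: (le_trans (lerD (lexx _) dnus)); rewrite -mulrSr -[leLHS]mulr_natr divfK//.
Qed.

End grothendieck_pietsch.

(** * The estimate and its sufficiency *)

Section estimate.
Context (R : realType) (s : scalars) (E : frechetType R s).
Context (l l' : lambda_space R s) (B C : kothe_matrix R).
Local Notation K := (scalar_field R s).

(** Fixing [N] and [r] lets a failing [r] be chosen for each [N]. In the extended reals the inverse
    of 0 is [+oo] and 0 times [+oo] is 0, which gives the conventions for degenerate quotients and
    products. *)
Definition estimate_at (N_ : nat -> nat) (N r : nat) :=
  exists (k0 : nat) (M : R), 0 < M /\
  forall (i j : nat) (u : {linear E -> K^o}), continuous u ->
    let max1 := \big[maxe/0%E]_(k < k0.+1)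
                  (dualnorm (N_ k) u * (B i k)%:E)%E in
    let max2 := \big[maxe/0%E]_(k < k0.+1)
                  ((C j k)%:E / (B i (N_ k))%:E)%E in
    [\/ max1 = +oo%E, max2 = +oo%E |
        ((C j r)%:E * dualnorm N u <= M%:E * max1 * max2)%E].

Definition factorization_estimate := forall N_ : nat -> nat,
  exists N : nat, forall r : nat, estimate_at N_ N r.

Lemma kothe_matrix_mono (A : kothe_matrix R) i k m : (k <= m)%N -> A i k <= A i m.
Proof.
move=> /subnK <-; elim: (m - k)%N => //= n IH.
by rewrite addSn (le_trans IH)// kothe_mono.
Qed.

Lemma estimate_bounded_factorization : nuclear (kothe_space l B) ->
  factorization_estimate ->
  bounded_factorization E (kothe_space l B) (kothe_space l' C).
Proof.
move=> nuclB est T Tc [S [Q [Sc Qc TE]]].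
have /choice[qV qVP] : forall k, exists qV : nat * R, (k <= qV.1)%N /\
    forall m, \sum_(0 <= i < m) B i k / B i qV.1 <= qV.2.
  by move=> k; have [q kq [V qV]] := nuclear_kothe_summable nuclB k; exists (q, V).
pose q k := (qV k).1.
have /choice[a aP] : forall k, exists a : nat * R, 0 < a.2 /\
    forall x, seminorm (q k) (S x) <= a.2 * seminorm a.1 x.
  by move=> k; have [n [c c0 cP]] := continuous_linear_seminorm Sc (q k); exists (n, c).
have /choice[b bP] : forall k, exists b : nat * R, 0 < b.2 /\
    forall y, seminorm k (Q y) <= b.2 * seminorm b.1 y.
  by move=> k; have [n [c c0 cP]] := continuous_linear_seminorm Qc k; exists (n, c).
pose N_ k := maxn (a k).1 (b k).1.
have [N NP] := est N_; exists N => r; have [k0 [M [M0 ineq]]] := NP r.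
(* Sums over [k] replace the maxima: they dominate them and are summable in [i] by exchanging the
   order of summation. *)
pose sigma i := \sum_(k < k0.+1) (a k).2 * (B i k / B i (q k)).
pose D := \sum_(k < k0.+1) (b k).2.
pose u i : {linear E -> K^o} := @kothe_coord _ _ l B i \o S.
have uc i : continuous (u i).
  move=> x; apply: (@continuous_comp _ _ _ S (@kothe_coord _ _ l B i)); first exact: Sc.
  exact: kothe_coord_continuous.
pose v i : kothe_space l' C := Q (kothe_unit l B i).
have ratio_ge0 i k m : 0 <= B i k / B i m by rewrite divr_ge0 ?kothe_ge0.
have sigma0 i : 0 <= sigma i.
  by apply: sumr_ge0 => k _; rewrite mulr_ge0// ltW//; have [] := aP k.
have max1_le i : (\big[maxe/0%E]_(k < k0.+1)
    (dualnorm (N_ k) (u i) * (B i k)%:E) <= (sigma i)%:E)%E.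
  apply: bigmax_le; first by rewrite lee_fin.
  move=> k _; have [a0 aS] := aP k; have [kq _] := qVP k.
  apply: (@le_trans _ _ ((a k).2 * (B i k / B i (q k)))%:E); last first.
    rewrite lee_fin /sigma (bigD1 k)//= lerDl; apply: sumr_ge0 => k' _.
    by rewrite mulr_ge0// ltW//; have [] := aP k'.
  have [Bk|Bk] := eqVneq (B i k) 0; first by rewrite Bk mule0 mul0r mulr0.
  have Bk0 : 0 < B i k by rewrite lt_neqAle eq_sym Bk kothe_ge0.
  have Bq0 : 0 < B i (q k) by rewrite (lt_le_trans Bk0)// kothe_matrix_mono.
  have -> : (a k).2 * (B i k / B i (q k)) = (a k).2 / B i (q k) * B i k.
    by rewrite -mulrA [_^-1 * _]mulrC.
  rewrite EFinM lee_wpmul2r ?lee_fin ?kothe_ge0//.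
  apply: opnorm_le => x x1; rewrite ler_pdivlMr//.
  rewrite (le_trans (kothe_coord_le _ _ _))// (le_trans (aS x))//.
  rewrite ler_piMr ?(ltW a0)// (le_trans _ x1)// seminorm_mono//.
  exact: leq_maxl.
have v_le i k : seminorm k (v i) <= (b k).2 * B i (N_ k).
  have [b0 bQ] := bP k; rewrite (le_trans (bQ _))// seminorm_kothe_unit.
  by rewrite ler_wpM2l ?(ltW b0)// kothe_matrix_mono// leq_maxr.
have pointwise i j x : seminorm N x <= 1 ->
    rnorm (u i x) * (rnorm (kothe_coord j (v i)) * C j r) <=
    \sum_(k < k0.+1) M * sigma i / B i (N_ k) * (rnorm (kothe_coord j (v i)) * C j k).
  move=> x1.
  (* For a zero coordinate the claim is trivial; a nonzero one is what rules out an infinite second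
     maximum below. *)
  have [->|vij] := eqVneq (rnorm (kothe_coord j (v i))) 0.
    by rewrite mul0r mulr0 sumr_ge0// => k _; rewrite mul0r mulr0.
  have vij0 : 0 < rnorm (kothe_coord j (v i)) by rewrite lt_neqAle eq_sym vij rnorm_ge0.
  set m2 : R := \sum_(k < k0.+1) C j k / B i (N_ k).
  have m2_ge0 k : 0 <= C j k / B i (N_ k) by rewrite divr_ge0 ?kothe_ge0.
  have max2_le : (\big[maxe/0%E]_(k < k0.+1)
      ((C j k)%:E / (B i (N_ k))%:E) <= m2%:E)%E.
    apply: bigmax_le; first by rewrite lee_fin sumr_ge0.
    move=> k _; apply: (@le_trans _ _ (C j k / B i (N_ k))%:E); last first.
      by rewrite lee_fin /m2 (bigD1 k)//= lerDl sumr_ge0.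
    have [BN|BN] := eqVneq (B i (N_ k)) 0; last by rewrite inver (negPf BN).
    (* Here [v i] has [k]-th seminorm 0 by [v_le], so its nonzero [j]-th coordinate forces [C j k]
       to be 0, and the quotient is 0/0 rather than [+oo]. *)
    suff -> : C j k = 0 by rewrite mul0e mul0r.
    apply/eqP; rewrite eq_le kothe_ge0 andbT -(ler_pM2l vij0) mulr0.
    by rewrite (le_trans (kothe_coord_le _ _ _))// (le_trans (v_le _ _))// BN mulr0.
  have := ineq i j (u i) (uc i); case => [max1y|max2y|].
  - by have := max1_le i; rewrite max1y.
  - by have := max2_le; rewrite max2y.
  move=> le; have {}le : C j r * rnorm (u i x) <= M * sigma i * m2.
    rewrite -lee_fin; apply: (@le_trans _ _ ((C j r)%:E * dualnorm N (u i))%E).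
      by rewrite EFinM lee_wpmul2l ?lee_fin ?kothe_ge0// le_opnorm.
    apply: (le_trans le); rewrite EFinM EFinM lee_pmul//.
    + by rewrite mule_ge0 ?lee_fin ?(ltW M0)// bigmax_ge_id.
    + exact: bigmax_ge_id.
    + by rewrite lee_wpmul2l ?lee_fin ?(ltW M0).
  rewrite mulrCA [rnorm (u i x) * _]mulrC.
  rewrite (le_trans (ler_wpM2l (ltW vij0) le))// le_eqVlt; apply/predU1P; left.
  rewrite /m2 mulr_sumr mulr_sumr; apply: eq_bigr => k _.
  rewrite mulrCA -[RHS]mulrA.
  by congr (_ * _); rewrite [LHS]mulrA [LHS]mulrC.
have term_le i x : seminorm N x <= 1 ->
    rnorm (u i x) * seminorm r (v i) <= M * sigma i * D.
  move=> x1; rewrite kothe_seminormE /kothe_norm -rnormZ.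
  have c_ge0 k : 0 <= M * sigma i / B i (N_ k).
    by rewrite !mulr_ge0 ?invr_ge0 ?kothe_ge0 ?(ltW M0).
  (* By [pointwise], the coordinates of [u i x *: kothe_elt r (v i)] are dominated by the sum of
     those of the [w k], so the norm in [l'] passes to a sum over [k]. *)
  pose w k := of_real s (M * sigma i / B i (N_ k)) *: kothe_elt k (v i).
  apply: (@le_trans _ _ (\sum_(k < k0.+1) rnorm (w k))).
    apply: lambda_norm_le_sum => j.
    have scaled k (z : K) : rnorm (Defs.coord l' (z *: kothe_elt k (v i)) j) =
        rnorm z * (rnorm (kothe_coord j (v i)) * C j k).
      rewrite linearZ/= -[X in rnorm X]/(z * Defs.coord l' (kothe_elt k (v i)) j).
      rewrite coord_kothe_elt /weighted rnormM rnormM rnorm_of_real.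
      by rewrite ger0_norm ?kothe_ge0.
    rewrite scaled (le_trans (pointwise i j x x1))// ler_sum// => k _.
    by rewrite scaled rnorm_of_real ger0_norm.
  rewrite /D mulr_sumr ler_sum// => k _; rewrite /w rnormZ rnorm_of_real ger0_norm//.
  have Ms : 0 <= M * sigma i by rewrite mulr_ge0// ltW.
  rewrite -mulrA ler_wpM2l//.
  have [BN|BN] := eqVneq (B i (N_ k)) 0.
    by rewrite BN invr0 mul0r ltW//; have [] := bP k.
  rewrite mulrC ler_pdivrMr ?v_le//.
  by rewrite lt_neqAle eq_sym BN kothe_ge0.
pose V := \sum_(k < k0.+1) (a k).2 * (qV k).2.
have sigmaV n : \sum_(0 <= i < n) sigma i <= V.
  rewrite /sigma exchange_big/= ler_sum// => k _.
  rewrite -mulr_sumr ler_wpM2l//; first by rewrite ltW//; have [] := aP k.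
  by have [_] := qVP k; apply.
have D0 : 0 <= D by rewrite sumr_ge0// => k _; rewrite ltW//; have [] := bP k.
apply: (@le_lt_trans _ _ (M * D * V)%:E); last by rewrite ltry.
apply: opnorm_le => x x1; apply/ler_addgt0Pr => e e0.
have [b0 bQ] := bP r.
(* Only a finite section of [S x] is fed into [term_le]; its length is chosen so that [Q] sends the
   remainder to something smaller than [e]. *)
have [n0 /(_ n0 (leqnn n0))] := (cvg_seminormP _ _).1 (kothe_expansion (y := S x))
  (b r).1 (e / (b r).2) (divr_gt0 e0 b0).
set P := \sum_(0 <= i < n0) _ => PS.
have -> : T x = Q P + Q (S x - P).
  by rewrite -linearD/= addrC subrK -[T x]/((T : E -> _) x) TE.
rewrite (le_trans (seminormD _ _ _))// lerD//.
  rewrite linear_sum (le_trans (seminorm_sum _ _ _ _))//.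
  apply: (@le_trans _ _ (\sum_(0 <= i < n0) M * D * sigma i)).
    apply: ler_sum => i _; rewrite linearZ/= seminormZ.
    by rewrite (le_trans (term_le i x x1))// mulrAC.
  by rewrite -mulr_sumr ler_wpM2l// mulr_ge0// ltW.
rewrite (le_trans (bQ _))// mulrC -ler_pdivlMr// seminorm_distC.
exact: ltW.
Qed.

End estimate.

(** * Dependence of operator sums on the selected indices *)

Section series_sum.
Context (R : realType) (s : scalars) (E F : frechetType R s).
Variables (S : nat -> {linear E -> F}) (N_ : nat -> nat).

Definition series_sum (th : pred nat) (T : {linear E -> F}) :=
  forall k t x, (k <= t)%N ->
    seminorm k (T x - \sum_(0 <= n < t | th n) S n x)
      <= 2^-1 ^+ t * (2 * seminorm (N_ k) x).

(** Beyond [t0] the partial sums no longer change, while their distance to [T x] tends to 0. *)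
Lemma series_sum_finite th T t0 x : series_sum th T ->
  (forall n, (t0 <= n)%N -> th n = false) ->
  T x = \sum_(0 <= n < t0 | th n) S n x.
Proof.
move=> Tth th0; apply/eqP; rewrite -subr_eq0; apply/eqP/seminorm_separating => k.
apply/eqP; rewrite eq_le seminorm_ge0 andbT.
apply: (@half_pow_le0 _ (maxn k t0) _ (2 * seminorm (N_ k) x)) => t.
rewrite geq_max => /andP[kt t0t]; have := Tth k t x kt.
have tail0 : \sum_(t0 <= n < t | th n) S n x = 0.
  by rewrite big_nat_cond big1// => n /andP[/andP[/th0 ->]].
by rewrite (big_cat_nat (n := t0))//= tail0 addr0.
Qed.

(** Both operators lie within [2 * 2^-t] of the same partial sum, whence the factor 4. *)
Lemma series_sum_close th th' T T' t k x : series_sum th T -> series_sum th' T' ->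
  (forall n, (n < t)%N -> th' n = th n) -> (k <= t)%N ->
  seminorm k (T' x - T x) <= 2^-1 ^+ t * (4 * seminorm (N_ k) x).
Proof.
move=> Tth Tth' th_th' kt.
have sumE : \sum_(0 <= n < t | th' n) S n x = \sum_(0 <= n < t | th n) S n x.
  rewrite big_nat_cond [RHS]big_nat_cond; apply: eq_bigl => n.
  by case: (ltnP n t) => // nt; rewrite th_th'.
have -> : T' x - T x = (T' x - \sum_(0 <= n < t | th' n) S n x) -
    (T x - \sum_(0 <= n < t | th n) S n x) by rewrite sumE opprB addrA subrK.
rewrite (le_trans (seminormB _ _ _))//.
rewrite (le_trans (lerD (Tth' k t x kt) (Tth k t x kt)))// -mulrDr -mulrDl.
by rewrite -natrD.
Qed.

End series_sum.

(** * The Baire category argument for pairs of operator series *)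

Section gliding_hump.
Context (R : realType) (s : scalars) (E F G : frechetType R s).
Variables (S : nat -> {linear E -> F}) (Q : nat -> {linear F -> G}).
Variables (N_ r_ : nat -> nat).
Hypothesis Sc : forall n, continuous (S n).
Hypothesis Qc : forall n, continuous (Q n).
Hypothesis Sle : forall k n x, (k <= n)%N ->
  seminorm k (S n x) <= 2^-1 ^+ n * seminorm (N_ k) x.
Hypothesis Qle : forall k n y, (k <= n)%N ->
  seminorm k (Q n y) <= 2^-1 ^+ n * seminorm (N_ k) y.

(** The bound involves only [T] and [P], hence is uniform over all [T'] and [P'] selected by the
    same indices below [t]: this gives the open sets of the category argument. *)
Lemma composition_series_close (th th' eta eta' : pred nat) t
    (T T' : {linear E -> F}) (P P' : {linear F -> G}) k h (c : R) x :
  series_sum S N_ th T -> series_sum S N_ th' T' ->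
  series_sum Q N_ eta P -> series_sum Q N_ eta' P' ->
  (forall n, (n < t)%N -> th' n = th n) -> (forall n, (n < t)%N -> eta' n = eta n) ->
  0 <= c -> (forall y, seminorm k (P y) <= c * seminorm h y) ->
  (k <= t)%N -> (h <= t)%N -> (N_ k <= t)%N ->
  seminorm k (P' (T' x) - P (T x)) <= 2^-1 ^+ t *
   (4 * (seminorm (N_ k) (T x) + 4 * seminorm (N_ (N_ k)) x) + c * (4 * seminorm (N_ h) x)).
Proof.
move=> Tth Tth' Peta Peta' th_th' eta_eta' c0 Pc kt ht Nkt.
have -> : P' (T' x) - P (T x) = (P' (T' x) - P (T' x)) + P (T' x - T x).
  by rewrite linearB/= addrA subrK.
have t0 : 0 <= 2^-1 ^+ t :> R by rewrite exprn_ge0 ?invr_ge0.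
rewrite (le_trans (seminormD _ _ _))// mulrDr lerD//; last first.
  rewrite (le_trans (Pc _))// mulrCA ler_wpM2l//.
  exact: (series_sum_close _ Tth Tth').
rewrite (le_trans (series_sum_close _ Peta Peta' eta_eta' kt))//.
rewrite ler_wpM2l// ler_wpM2l// -[T' x](subrK (T x)) addrC.
rewrite (le_trans (seminormD _ _ _))// lerD2l.
rewrite (le_trans (series_sum_close _ Tth Tth' th_th' Nkt))//.
rewrite ler_piMl// ?mulr_ge0 ?seminorm_ge0// exprn_ile1 ?invr_ge0//.
by rewrite invf_le1// ler1n.
Qed.

Hypothesis hump : forall n, exists2 x, seminorm (logn 2 n) x <= 1 &
  n%:R < seminorm (r_ (logn 2 n)) (Q n (S n x)).

Lemma logn2_cofinal N p : exists2 n, (p <= n)%N & logn 2 n = N.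
Proof.
exists (2 ^ N * (p.*2.+1))%N.
  rewrite -addnn (leq_trans (leq_addr p p))// (leq_trans (leqnSn _))//.
  by rewrite leq_pmull// expn_gt0.
rewrite lognM ?expn_gt0// pfactorK// logn_coprime ?addn0//.
by rewrite coprime2n /= odd_double.
Qed.

(* Flipping the n-th coefficients of both series reproduces [Q n (S n x)] as an
   alternating sum of four values, so one of them is large. *)
Lemma unbounded_composition : exists (T : {linear E -> F}) (P : {linear F -> G}),
  [/\ continuous T, continuous P & forall N (M : R),
    exists2 x, seminorm N x <= 1 & M < seminorm (r_ N) (P (T x))].
Proof.
have /choice[T TP] : forall c : nat -> bool * bool, exists T : {linear E -> F},
    continuous T /\ series_sum S N_ (fun n => (c n).1) T.
  move=> c; have [T Tc TP] := operator_series Sc Sle (fun n => (c n).1).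
  by exists T.
have /choice[P PP] : forall c : nat -> bool * bool, exists P : {linear F -> G},
    continuous P /\ series_sum Q N_ (fun n => (c n).2) P.
  move=> c; have [P Pc PP] := operator_series Qc Qle (fun n => (c n).2).
  by exists P.
(* The number [m] encodes both the source index [logn 2 m] and the threshold; every index occurs
   with arbitrarily large thresholds. *)
pose big m c := exists2 x, seminorm (logn 2 m) x <= 1 &
  m%:R < seminorm (r_ (logn 2 m)) (P c (T c x)).
pose U m c t := forall c', (forall n, (n < t)%N -> c' n = c n) -> big m c'.
have [|c cU] := @seq_baire _ (false, false) U; last first.
  exists (T c), (P c); have [Tc _] := TP c; have [Pc _] := PP c; split => // N M.
  have M1 := archi_boundP (normr_ge0 M).
  have [m Mm mN] := logn2_cofinal N (Num.bound `|M|).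
  have [t [b [cb bU]]] := cU m.
  have [x] := bU c cb; rewrite mN => x1 mx; exists x => //.
  rewrite (le_lt_trans (ler_norm M))// (lt_trans M1)//.
  by rewrite (le_lt_trans _ mx)// ler_nat.
move=> m t a.
(* The hump lies beyond the prescribed entries, has the same source index, and has size at least
   [4 * m.+1], one [m.+1] for each of the four values. *)
have [n mn nN] := logn2_cofinal (logn 2 m) (maxn t (4 * m.+1)).
move: mn; rewrite geq_max => /andP[tn mn].
have [x] := hump n; rewrite nN => x1 nx; set r := r_ (logn 2 m) in nx.
(* Cutting [a] off at [t] makes all sums finite, and the four selections [c pq] differ at [n]
   only. *)
pose a0 j := if (j < t)%N then a j else (false, false).
pose c pq j := if j == n then pq else a0 j.
pose W pq := P (c pq) (T (c pq) x).
have c_out pq j : (n.+1 <= j)%N -> c pq j = (false, false).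
  by move=> nj; rewrite /c gtn_eqF// /a0 ltnNge (leq_trans tn) ?(ltnW nj).
pose y := \sum_(0 <= j < n | (a0 j).1) S j x.
pose H z := \sum_(0 <= j < n | (a0 j).2) Q j z.
have HD z z' : H (z + z') = H z + H z'.
  by rewrite /H -big_split/=; apply: eq_bigr => j _; rewrite linearD.
have TE pq : T (c pq) x = y + (if pq.1 then S n x else 0).
  rewrite (series_sum_finite (t0 := n.+1) x (TP (c pq)).2); last first.
    by move=> j nj; rewrite c_out.
  rewrite big_mkcond big_nat_recr//= /c eqxx -big_mkcond/=; congr (_ + _).
  rewrite big_nat_cond [RHS]big_nat_cond; apply: eq_bigl => j.
  by case: (ltnP j n) => //= jn; rewrite ltn_eqF.
have PE pq z : P (c pq) z = H z + (if pq.2 then Q n z else 0).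
  rewrite (series_sum_finite (t0 := n.+1) z (PP (c pq)).2); last first.
    by move=> j nj; rewrite c_out.
  rewrite big_mkcond big_nat_recr//= /c eqxx -big_mkcond/=; congr (_ + _).
  rewrite big_nat_cond [RHS]big_nat_cond; apply: eq_bigl => j.
  by case: (ltnP j n) => //= jn; rewrite ltn_eqF.
have polar : Q n (S n x) =
    W (true, true) - W (true, false) - (W (false, true) - W (false, false)).
  rewrite /W !TE !PE /= !addr0 [H (y + _) + _]addrC addrK [H y + _]addrC addrK.
  by rewrite linearD/= addrC addKr.
have [pq Wpq] : exists pq, m.+1%:R < seminorm r (W pq).
  apply: contrapT => /forallNP small.
  have {}small pq : seminorm r (W pq) <= m.+1%:R.
    by rewrite leNgt; apply/negP; exact: small.
  suff : seminorm r (Q n (S n x)) <= n%:R by rewrite leNgt nx.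
  apply: (@le_trans _ _ (4 * m.+1)%:R); last by rewrite ler_nat.
  rewrite polar (_ : (4 * m.+1)%:R = (m.+1%:R + m.+1%:R) + (m.+1%:R + m.+1%:R)); last first.
    by rewrite -!natrD !mulSn mul0n addn0 !addnA.
  by rewrite (le_trans (seminormB _ _ _))// lerD// (le_trans (seminormB _ _ _))// lerD.
have [Tc Tser] := TP (c pq); have [Pc Pser] := PP (c pq).
have [h [d d0 hP]] := continuous_linear_seminorm Pc r.
set B := 4 * (seminorm (N_ r) (T (c pq) x) + 4 * seminorm (N_ (N_ r)) x) +
  d * (4 * seminorm (N_ h) x).
have B0 : 0 <= B by rewrite addr_ge0 ?mulr_ge0 ?addr_ge0 ?mulr_ge0 ?seminorm_ge0 ?(ltW d0).
have B1 : 0 < B + 1 by rewrite ltr_wpDl.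
have [t1 t1B] : exists t, 2^-1 ^+ t < (B + 1)^-1 by apply: half_pow_lt; rewrite invr_gt0.
(* From [t'] on a change of the selection moves the value by at most [B / (B + 1)]; the spare unit
   in [m.+1] absorbs it. *)
pose t' := maxn t.+1 (maxn t1 (maxn r (maxn h (N_ r)))).
have t't1 : (t1 <= t')%N by rewrite !leq_max leqnn orbT.
have t'r : (r <= t')%N by rewrite !leq_max leqnn !orbT.
have t'h : (h <= t')%N by rewrite !leq_max leqnn !orbT.
have t'N : (N_ r <= t')%N by rewrite !leq_max leqnn !orbT.
exists t', (c pq); split.
- by rewrite leq_max ltnSn.
- move=> j jt; rewrite /c ltn_eqF; last exact: leq_trans tn.
  by rewrite /a0 jt.
move=> c' c'c; exists x => //; rewrite -/r.
have [_ T'ser] := TP c'; have [_ P'ser] := PP c'.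
have := @composition_series_close _ _ _ _ t' _ _ _ _ r h d x Tser T'ser Pser P'ser.
move=> /(_ _ _ (ltW d0) hP t'r t'h t'N); rewrite -/B => close.
have {}close : seminorm r (P c' (T c' x) - W pq) <= 1.
  apply: le_trans (close _ _) _; [by move=> j /c'c -> | by move=> j /c'c -> |].
  rewrite (le_trans (ler_wpM2r B0 (half_pow_anti R t't1)))//.
  rewrite (le_trans (ler_wpM2r B0 (ltW t1B)))// mulrC ler_pdivrMr//.
  by rewrite mul1r lerDl.
rewrite -(ltrD2r 1) natr1 (lt_le_trans Wpq)//.
rewrite -[W pq](subKr (P c' (T c' x))) (le_trans (seminormB _ _ _))//.
by rewrite lerD2l.
Qed.

End gliding_hump.

(** * Necessity of the estimate *)

Section necessity.
Context (R : realType) (s : scalars) (E : frechetType R s).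
Context (l l' : lambda_space R s) (B C : kothe_matrix R).
Local Notation K := (scalar_field R s).

(** The maxima [m1] and [m2] may be 0 but will serve as divisors, so they are enlarged within the
    strict gap. *)
Lemma perturb_product (M m1 m2 L : R) : 0 <= M -> 0 <= m1 -> 0 <= m2 ->
  M * m1 * m2 < L -> exists2 d : R, 0 < d & M * (m1 + d) * (m2 + d) < L.
Proof.
move=> M0 m10 m20 gap.
have c0 : 0 < M * (m1 + m2 + 1) + 1 by rewrite ltr_wpDl// mulr_ge0// !addr_ge0.
pose d := Num.min 1 ((L - M * m1 * m2) / (M * (m1 + m2 + 1) + 1)).
have d0 : 0 < d by rewrite lt_min ltr01 divr_gt0// subr_gt0.
have d1 : d <= 1 by rewrite ge_min lexx.
exists d => //; rewrite -subr_gt0.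
have dgap : d * (M * (m1 + m2 + 1) + 1) <= L - M * m1 * m2.
  by rewrite -ler_pdivlMr// ge_min lexx orbT.
rewrite (lt_le_trans d0)// -(lerD2r (M * (m1 + d) * (m2 + d))) subrK.
rewrite -(lerD2r (- (M * m1 * m2))) (le_trans _ dgap)//.
have -> : d + M * (m1 + d) * (m2 + d) - M * m1 * m2 = d * (M * (m1 + m2 + d) + 1).
  by ring.
by rewrite ler_wpM2l ?(ltW d0)// lerD2r ler_wpM2l// lerD2l.
Qed.

(** The operators are [u] tensor [e_i] and [e_i'] tensor [e_j], divided by the slightly enlarged
    maxima and each scaled by [2^-n]. In the constant, the two powers of 2 offset these scalings and
    [n.+1] is left as the size of the composition. *)
Lemma rank_one_hump (N_ : nat -> nat) (N r n i j : nat) (u : {linear E -> K^o}) :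
  continuous u ->
  let max1 := \big[maxe/0%E]_(k < n.+1)
                (dualnorm (N_ k) u * (B i k)%:E)%E in
  let max2 := \big[maxe/0%E]_(k < n.+1)
                ((C j k)%:E / (B i (N_ k))%:E)%E in
  max1 <> +oo%E -> max2 <> +oo%E ->
  ~ ((C j r)%:E * dualnorm N u <= (n.+1%:R * (2 ^+ n * 2 ^+ n))%:E * max1 * max2)%E ->
  exists (S : {linear E -> kothe_space l B})
         (Q : {linear kothe_space l B -> kothe_space l' C}),
  [/\ continuous S /\ continuous Q,
      forall k x, (k <= n)%N -> seminorm k (S x) <= 2^-1 ^+ n * seminorm (N_ k) x,
      forall k y, (k <= n)%N -> seminorm k (Q y) <= 2^-1 ^+ n * seminorm (N_ k) y &
      exists2 x, seminorm N x <= 1 & n%:R < seminorm r (Q (S x))].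
Proof.
move=> uc max1 max2 max1y max2y.
have dual_ge0 k : (0 <= dualnorm k u)%E.
  by apply: opnorm_ge0 => *; rewrite ?rnorm_ge0 ?seminormZ.
have fin_max (f : 'I_n.+1 -> \bar R) : \big[maxe/0%E]_(k < n.+1) f k <> +oo%E ->
    exists2 m : R, 0 <= m & \big[maxe/0%E]_(k < n.+1) f k = m%:E.
  move=> /eqP fy; exists (fine (\big[maxe/0%E]_(k < n.+1) f k)).
    by rewrite fine_ge0// bigmax_ge_id.
  by rewrite fineK// ge0_fin_numE ?bigmax_ge_id// ltey.
have [m1 m10 m1E] := fin_max _ max1y; have [m2 m20 m2E] := fin_max _ max2y.
rewrite /max1 /max2 m1E m2E -!EFinM => /negP; rewrite -ltNge => gap.
set M : R := n.+1%:R * (2 ^+ n * 2 ^+ n) in gap.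
have M0 : 0 <= M by rewrite !mulr_ge0// exprn_ge0.
have Cjr0 : 0 < C j r.
  rewrite lt_neqAle eq_sym kothe_ge0 andbT; apply/negP => /eqP Cjr.
  by move: gap; rewrite Cjr mul0e lte_fin ltNge !mulr_ge0.
have [x x1 {}gap] : exists2 x, seminorm N x <= 1 & M * m1 * m2 < C j r * rnorm (u x).
  have : ((M * m1 * m2 / C j r)%:E < dualnorm N u)%E.
    rewrite -(@lte_pmul2l _ (C j r)%:E)//.
    by rewrite -EFinM mulrC divfK ?gt_eqF.
  move=> /ereal_sup_gt[_ [x /= x1 <-]]; rewrite lte_fin ltr_pdivrMr// => gapx.
  by exists x => //; rewrite [ltRHS]mulrC.
have [d d0 {}gap] := perturb_product M0 m10 m20 gap.
have m1d : 0 < m1 + d by rewrite ltr_wpDl.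
have m2d : 0 < m2 + d by rewrite ltr_wpDl.
have h0 : 0 < 2^-1 ^+ n :> R by rewrite exprn_gt0// invr_gt0.
pose a := 2^-1 ^+ n / (m1 + d); pose b := 2^-1 ^+ n / (m2 + d).
have a0 : 0 < a by rewrite divr_gt0.
have b0 : 0 < b by rewrite divr_gt0.
pose S : {linear E -> kothe_space l B} := rank_one u (of_real s a *: kothe_unit l B i).
pose Q : {linear kothe_space l B -> kothe_space l' C} :=
  rank_one (@kothe_coord _ _ l B i) (of_real s b *: kothe_unit l' C j).
have unit_norm (l0 : lambda_space R s) A i0 k (z : R) : 0 < z ->
    seminorm k (of_real s z *: kothe_unit l0 A i0) = z * A i0 k.
  by move=> z0; rewrite seminormZ seminorm_kothe_unit rnorm_of_real gtr0_norm.
have normalize (w c m t : R) : 0 < m -> w * c <= m * t ->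
    w * (2^-1 ^+ n / m * c) <= 2^-1 ^+ n * t.
  by move=> m0 wc; rewrite mulrCA -mulrA ler_pM2l// ler_pdivrMl.
exists S, Q; split.
- split; apply: rank_one_continuous => //; exact: kothe_coord_continuous.
- move=> k z kn; rewrite rank_one_seminorm unit_norm//.
  apply: normalize => //.
  have := le_bigmax_cond 0%E (fun k : 'I_n.+1 => (dualnorm (N_ k) u * (B i k)%:E)%E)
    (isT : xpredT (Ordinal (kn : (k < n.+1)%N))).
  rewrite m1E /= => uB.
  have [Bik|Bik] := eqVneq (B i k) 0.
    by rewrite Bik mulr0 mulr_ge0 ?seminorm_ge0// ltW.
  have Bik0 : 0 < B i k by rewrite lt_neqAle eq_sym Bik kothe_ge0.
  have : (dualnorm (N_ k) u <= (m1 / B i k)%:E)%E.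
    by rewrite -(@lee_pmul2r _ (B i k)%:E)// -EFinM divfK.
  move=> /functional_opnorm_bound/(_ z) uz.
  rewrite -ler_pdivlMr// mulrAC (le_trans (uz _ _))//.
  + by move=> *; rewrite seminormZ.
  + by move=> *; rewrite seminorm_ge0.
  by rewrite ler_wpM2r ?seminorm_ge0// ler_pM2r ?invr_gt0// lerDl ltW.
- move=> k z kn; rewrite rank_one_seminorm unit_norm//.
  apply: normalize => //.
  have := le_bigmax_cond 0%E (fun k : 'I_n.+1 => ((C j k)%:E / (B i (N_ k))%:E)%E)
    (isT : xpredT (Ordinal (kn : (k < n.+1)%N))).
  rewrite m2E /= inver.
  have [Cjk|Cjk] := eqVneq (C j k) 0.
    by rewrite Cjk mulr0 mulr_ge0 ?seminorm_ge0// ltW.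
  have Cjk0 : 0 < C j k by rewrite lt_neqAle eq_sym Cjk kothe_ge0.
  (* A zero denominator under a positive [C j k] would make the second maximum infinite. *)
  case: ifPn => BN; first by rewrite gt0_muley.
  have BN0 : 0 < B i (N_ k) by rewrite lt_neqAle eq_sym BN kothe_ge0.
  rewrite -EFinM lee_fin ler_pdivrMr// => CB.
  rewrite (le_trans (ler_wpM2l (rnorm_ge0 _) CB))// mulrCA.
  apply: (@le_trans _ _ (m2 * seminorm (N_ k) z)).
    by rewrite ler_wpM2l// kothe_coord_le.
  by rewrite ler_wpM2r ?seminorm_ge0// lerDl ltW.
- exists x => //; rewrite rank_one_seminorm unit_norm//.
  have -> : rnorm (kothe_coord i (S x)) = rnorm (u x) * a.
    rewrite /S /rank_one !linearZ/= rnormM; congr (_ * _).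
    by rewrite rnormM rnorm_of_real gtr0_norm// (rnorm_kothe_coord_unit l B) mulr1.
  have -> : rnorm (u x) * a * (b * C j r) = (a * b) * (C j r * rnorm (u x)) by ring.
  apply: (@lt_trans _ _ n.+1%:R); first by rewrite ltr_nat.
  have -> : n.+1%:R = a * b * (M * (m1 + d) * (m2 + d)).
    rewrite /a /b /M !exprVn; field.
    by rewrite !gt_eqF// exprn_gt0.
  by rewrite ltr_pM2l// mulr_gt0.
Qed.

Lemma bounded_factorization_estimate :
  bounded_factorization E (kothe_space l B) (kothe_space l' C) ->
  factorization_estimate E B C.
Proof.
move=> BF N_; apply: contrapT => /forallNP fail.
have /choice[r_ rP] : forall N, exists r, ~ estimate_at E B C N_ N r.
  by move=> N; apply/existsNP/fail.
have /choice[SQ SQP] : forall n, exists SQ : {linear E -> kothe_space l B} *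
    {linear kothe_space l B -> kothe_space l' C},
  [/\ continuous SQ.1 /\ continuous SQ.2,
      forall k x, (k <= n)%N -> seminorm k (SQ.1 x) <= 2^-1 ^+ n * seminorm (N_ k) x,
      forall k y, (k <= n)%N -> seminorm k (SQ.2 y) <= 2^-1 ^+ n * seminorm (N_ k) y &
      exists2 x, seminorm (logn 2 n) x <= 1 &
        n%:R < seminorm (r_ (logn 2 n)) (SQ.2 (SQ.1 x))].
  move=> n; apply: contrapT => /forallNP nohump; apply: (rP (logn 2 n)).
  (* Without a hump at stage [n] the estimate would hold for [logn 2 n] with [k0 = n] and this
     constant, against the choice of [r_]. *)
  exists n, (n.+1%:R * (2 ^+ n * 2 ^+ n)); split.
    by rewrite !mulr_gt0// exprn_gt0.
  move=> i j u uc max1 max2.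
  have [->|/eqP max1y] := eqVneq max1 +oo%E; first by constructor 1.
  have [->|/eqP max2y] := eqVneq max2 +oo%E; first by constructor 2.
  constructor 3; apply: contrapT => gap.
  have [S [Q SQ]] := @rank_one_hump N_ (logn 2 n) (r_ (logn 2 n)) n i j u uc max1y max2y gap.
  exact: (nohump (S, Q)).
have [||||n|T [P [Tc Pc unb]]] := @unbounded_composition _ _ _ _ _
  (fun n => (SQ n).1) (fun n => (SQ n).2) N_ r_.
- by move=> n; have [[]] := SQP n.
- by move=> n; have [[]] := SQP n.
- by move=> k n x; have [_ + _ _] := SQP n; apply.
- by move=> k n x; have [_ _ + _] := SQP n; apply.
- by have [_ _ _] := SQP n.
have PTc : continuous (P \o T) by move=> x; apply: continuous_comp; [exact: Tc|exact: Pc].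
(* Boundedness supplies one [N] for all target seminorms; the one indexed by [r_ N] contradicts
   [unb]. *)
have [N /(_ (r_ N)) bnd] := BF (P \o T) PTc (ex_intro _ T (ex_intro _ P (And3 Tc Pc erefl))).
have opN x : seminorm N x <= 1 -> ((seminorm (r_ N) (P (T x)))%:E <=
    opnorm (seminorm N : E -> R) (seminorm (r_ N) : kothe_space l' C -> R) (P \o T))%E.
  by move=> x1; apply: (@le_opnorm _ _ _ _ _ _ (P \o T)).
have opfin : opnorm (seminorm N : E -> R) (seminorm (r_ N) : kothe_space l' C -> R)
    (P \o T) \is a fin_num.
  rewrite ge0_fin_numE//; apply: (le_trans _ (opN 0 _)); rewrite ?seminorm0//.
  by rewrite lee_fin seminorm_ge0.
have [x x1] := unb N (fine (opnorm (seminorm N : E -> R)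
  (seminorm (r_ N) : kothe_space l' C -> R) (P \o T))).
by rewrite -lte_fin fineK// ltNge opN.
Qed.

End necessity.

Theorem theorem3p2 (R : realType) (s : scalars) (E : frechetType R s)
    (l l' : lambda_space R s) (B C : kothe_matrix R)
    (nuclB : nuclear (kothe_space l B)) :
  bounded_factorization E (kothe_space l B) (kothe_space l' C) <->
  forall N_ : nat -> nat, exists N : nat, forall r : nat,
  exists (k0 : nat) (M : R), 0 < M /\
  forall (i j : nat) (u : {linear E -> (scalar_field R s)^o}), continuous u ->
    let max1 := \big[maxe/0%E]_(k < k0.+1)
                  (dualnorm (N_ k) u * (B i k)%:E)%E in
    let max2 := \big[maxe/0%E]_(k < k0.+1)
                  ((C j k)%:E / (B i (N_ k))%:E)%E in
    [\/ max1 = +oo%E, max2 = +oo%E |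
        ((C j r)%:E * dualnorm N u <= M%:E * max1 * max2)%E].
Proof.
split; first exact: bounded_factorization_estimate.
exact: estimate_bounded_factorization.
Qed.
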